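(* For every map $\varphi\colon\mathbb{R}_+\to\mathbb{R}_+$ satisfying $\varphi(t)=o\left(t^{1/3}\right)$ as $t\to+\infty$, and for every irrational number $\theta$, there exists a rank-one system which has $e^{2i\pi\theta}$ as an eigenvalue and which is $\varphi$-integrably orbit equivalent to the universal odometer.
   Context: All probability spaces are standard and atomless. $\mathrm{Aut}(X,\mu)$ is the set of bimeasurable bijections $T$ of $(X,\mathcal{A},\mu)$ preserving the probability measure $\mu$, two such maps being identified if they coincide on a set of full measure. Its elements are called systems or transformations. A complex number $\lambda$ is an eigenvalue of $T$ if there is a nonzero $f\in L^2(X,\mathcal{A},\mu)$ with $f\circ T=\lambda f$ a.e. **Orbit equivalence.** Aperiodic $S\in\mathrm{Aut}(X,\mu)$ and $T\in\mathrm{Aut}(Y,\nu)$ are orbit equivalent if there is a bimeasurable bijection $\Psi\colon X\to Y$ with $\Psi_\star\mu=\nu$ such that $S$ and $\Psi^{-1}T\Psi$ have the same orbits at almost every point. The associated cocycles $c_S\colon X\to\mathbb{Z}$, $c_T\colon Y\to\mathbb{Z}$ are defined almost everywhere by $Sx=\Psi^{-1}T^{c_S(x)}\Psi(x)$ and $Ty=\Psi S^{c_T(y)}\Psi^{-1}(y)$. $S$ and $T$ are $\varphi$-integrably orbit equivalent if some orbit equivalence $\Psi$ satisfies $\int_X\varphi(|c_S|)\,d\mu<+\infty$ and $\int_Y\varphi(|c_T|)\,d\nu<+\infty$. **Universal odometer.** For integers $q_n\ge 2$, the odometer on $\prod_{n\ge0}\{0,\dots,q_n-1\}$ (with the product of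 the uniform probability measures) is the addition of $(1,0,0,\dots)$ with carry over to the right. It is universal if every prime number has infinite multiplicity as a prime factor among the $q_n$, $n\ge0$. The universal odometer is unique up to conjugacy. **Rank-one systems.** A cutting and spacing parameter is a tuple $(q,(\sigma_{\cdot,0},\dots,\sigma_{\cdot,q}))$ with an integer $q\ge2$ and non-negative integers $\sigma_{\cdot,i}$. For a sequence $(q_n,(\sigma_{n,0},\dots,\sigma_{n,q_n}))_{n\ge0}$ of these put $\sigma_n=\sum_{i=0}^{q_n}\sigma_{n,i}$, $h_0=1$, $h_{n+1}=q_nh_n+\sigma_n$. A transformation $T\in\mathrm{Aut}(X,\mu)$ is of rank one if there are such a sequence with $\sum_{n\ge0}\sigma_n/h_{n+1}<+\infty$ and measurable sets $B_n$, $B_{n,i}$ ($0\le i\le q_n-1$), $\Sigma_{n,i,j}$ ($0\le i\le q_n$, $1\le j\le\sigma_{n,i}$) such that for all $n\ge0$: (a) $B_n,T(B_n),\dots,T^{h_n-1}(B_n)$ are pairwise disjoint; (b) $(B_{n,0},\dots,B_{n,q_n-1})$ is a partition of $B_n$; (c) $T^{h_n}(B_{n,i})=\Sigma_{n,i+1,1}$ if $\sigma_{n,i+1}>0$, and $T^{h_n}(B_{n,i})=B_{n,i+1}$ if $\sigma_{n,i+1}=0$ and $i<q_n-1$; (d) if $\sigma_{n,i}>0$, then $T(\Sigma_{n,i,j})=\Sigma_{n,i,j+1}$ if $j<\sigma_{n,i}$, and $T(\Sigma_{n,i,j})=B_{n,i}$ if $j=\sigma_{n,i}$ and $i\le q_n-1$;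 (e) $B_{n+1}=\Sigma_{n,0,1}$ if $\sigma_{n,0}>0$, and $B_{n+1}=B_{n,0}$ if $\sigma_{n,0}=0$; and moreover $\{T^k(B_n)\mid n\ge0,\ 0\le k\le h_n-1\}$ generates $\mathcal{A}$ up to null sets. *)

(* Defs.v *)
From HB Require Import structures.
From mathcomp Require Export all_boot all_order all_algebra.
From mathcomp Require Export all_classical all_reals all_analysis.
From mathcomp Require Export complex.
Set Implicit Arguments.
Unset Strict Implicit.
Unset Printing Implicit Defensive.
Import Order.TTheory GRing.Theory Num.Theory numFieldNormedType.Exports.
Local Open Scope classical_set_scope.
Local Open Scope ring_scope.

(* A complete separable metric space, in the library's terms, is a Hausdorff
   second countable complete pseudometric space. *)
Definition standard_borel (R : realType) d (X : measurableType d) : Prop :=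
  exists (P : completePseudoMetricType R) (f : X -> P),
    [/\ hausdorff_space P, @second_countable P, bijective f &
        forall A : set X, measurable A <-> <<s @open P >> (f @` A)].

Definition atomless (R : realType) d (X : measurableType d)
    (mu : probability X R) : Prop :=
  forall A : set X, measurable A -> (0 < mu A)%E ->
    exists B : set X,
      [/\ measurable B, B `<=` A, (0 < mu B)%E & (mu B < mu A)%E].

Record mp_iso (R : realType) d1 (X : measurableType d1) (mu : probability X R)
    d2 (Y : measurableType d2) (nu : probability Y R) := MpIso {
  mp_fun :> X -> Y ;
  mp_inv : Y -> X ;
  mp_funK : cancel mp_fun mp_inv ;
  mp_invK : cancel mp_inv mp_fun ;
  measurable_mp_fun : measurable_fun setT mp_fun ;
  measurable_mp_inv : measurable_fun setT mp_inv ;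
  mp_pushforward : forall A : set Y, measurable A -> pushforward mu mp_fun A = nu A
}.

(* A class modulo null sets in Aut(X,mu) is represented by one of its elements;
   rank one, eigenvalues and orbit equivalence do not depend on the choice. *)
Notation automorphism mu := (mp_iso mu mu).

Section dynamics.
Context (R : realType) d (X : measurableType d) (mu : probability X R).
Implicit Types T : automorphism mu.

Definition iterz T (k : int) : X -> X :=
  match k with
  | Posz n => iter n T
  | Negz n => iter n.+1 (mp_inv T)
  end.

Definition orbit T (x : X) : set X := range (fun k : int => iterz T k x).

Definition aperiodic T : Prop :=
  {ae mu, forall x, forall n : nat, (0 < n)%N -> iter n T x <> x}.

(* Measurability and square-integrability of a complex function are expressed
   through its real and imaginary parts. *)
Definition is_eigenvalue T (lambda : R[i]) : Prop :=
  exists f : X -> R[i],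
    [/\ measurable_fun setT (fun x => complex.Re (f x)) /\
        measurable_fun setT (fun x => complex.Im (f x)),
        (\int[mu]_x (complex.Re (f x) ^+ 2 + complex.Im (f x) ^+ 2)%:E < +oo)%E,
        ~ {ae mu, forall x, f x = 0} &
        {ae mu, forall x, f (T x) = lambda * f x}].

End dynamics.

Section orbit_equivalence.
Context (R : realType) d1 (X : measurableType d1) (mu : probability X R)
  d2 (Y : measurableType d2) (nu : probability Y R).

Definition orbit_equivalence (S : automorphism mu) (T : automorphism nu)
    (Psi : mp_iso mu nu) : Prop :=
  {ae mu, forall x, orbit S x = mp_inv Psi @` orbit T (Psi x)}.

(* By aperiodicity the cocycles are unique up to null sets, and equal almost
   everywhere to measurable functions. *)
Definition integrably_orbit_equivalent (phi : R -> R)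
    (S : automorphism mu) (T : automorphism nu) : Prop :=
  [/\ aperiodic S, aperiodic T &
  exists Psi : mp_iso mu nu, orbit_equivalence S T Psi /\
  exists (cS : X -> int) (cT : Y -> int),
    [/\ (forall k : int, measurable (cS @^-1` [set k])) /\
        (forall k : int, measurable (cT @^-1` [set k])),
        {ae mu, forall x, S x = mp_inv Psi (iterz T (cS x) (Psi x))},
        {ae nu, forall y, T y = Psi (iterz S (cT y) (mp_inv Psi y))},
        (\int[mu]_x (phi (`|cS x|%N)%:R)%:E < +oo)%E &
        (\int[nu]_y (phi (`|cT y|%N)%:R)%:E < +oo)%E]].

End orbit_equivalence.

Section odometer.
Variable q : nat -> nat.

(* 'Z_(q n) has q n elements only when q n > 1, which universal_seq imposes. *)
Definition digits : Type := forall n : nat, 'Z_(q n).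

Definition digit_sets : set (set digits) :=
  [set A | exists (n : nat) (a : 'Z_(q n)), A = [set x : digits | x n = a]].

HB.instance Definition _ := Choice.copy digits (forall n : nat, 'Z_(q n)).
HB.instance Definition _ := isPointed.Build digits (fun n => 0).

Local Notation odometer_space := (g_sigma_algebraType digit_sets).

Definition is_uniform_product (R : realType)
    (nu : probability odometer_space R) : Prop :=
  forall (n : nat) (a : digits),
    nu [set x : digits | forall i, (i < n)%N -> x i = a i]
      = (\prod_(i < n) ((q i)%:R^-1 : R))%:E.

(* A digit is incremented iff all the preceding ones are maximal; in 'Z_(q n)
   the increment sends the maximal digit to 0. *)
Definition odometer (x : digits) : digits := fun n =>
  if [forall i : 'I_n, (x i).+1 == q i] then x n + 1 else x n.

(* These conditions determine both nu and S. *)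
Definition is_odometer (R : realType) (nu : probability odometer_space R)
    (S : automorphism nu) : Prop :=
  is_uniform_product nu /\ forall x, S x = odometer x.

Definition universal_seq : Prop :=
  (forall n, 2 <= q n)%N /\
  forall p : nat, prime p ->
    forall M : nat, exists N : nat, (M <= \sum_(n < N) logn p (q n))%N.

End odometer.

Notation odometer_space q := (g_sigma_algebraType (@digit_sets q)).

Section rank_one.
Variables (q : nat -> nat) (sigma : nat -> nat -> nat).

Definition spacers (n : nat) : nat := (\sum_(i < (q n).+1) sigma n i)%N.

Fixpoint height (n : nat) : nat :=
  if n is m.+1 then (q m * height m + spacers m)%N else 1%N.

(* Spacer levels Sg n i j are numbered from j = 1. The equalities between sets
   are exact: equalities up to null sets become exact after intersecting all
   the sets with a T-invariant set of full measure. *)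
Record tower_structure (R : realType) d (X : measurableType d)
    (mu : probability X R) (T : automorphism mu)
    (B : nat -> set X) (Bi : nat -> nat -> set X)
    (Sg : nat -> nat -> nat -> set X)
    (Tn := fun (k : nat) (A : set X) => iter k T @` A) : Prop := TowerStructure {
  measurable_base : forall n, measurable (B n) ;
  measurable_part : forall n i, (i < q n)%N -> measurable (Bi n i) ;
  measurable_spacer : forall n i j, (i <= q n)%N -> (1 <= j <= sigma n i)%N ->
    measurable (Sg n i j) ;
  tower_disjoint : forall n,
    trivIset [set k | (k < height n)%N] (fun k => Tn k (B n)) ;
  base_partition : forall n,
    partition [set i | (i < q n)%N] (Bi n) (B n) ;
  part_to_spacer : forall n i, (i < q n)%N -> (0 < sigma n i.+1)%N ->
    Tn (height n) (Bi n i) = Sg n i.+1 1%N ;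
  part_to_part : forall n i, (i.+1 < q n)%N -> sigma n i.+1 = 0%N ->
    Tn (height n) (Bi n i) = Bi n i.+1 ;
  spacer_to_spacer : forall n i j, (i <= q n)%N -> (1 <= j < sigma n i)%N ->
    T @` Sg n i j = Sg n i j.+1 ;
  spacer_to_part : forall n i, (i < q n)%N -> (0 < sigma n i)%N ->
    T @` Sg n i (sigma n i) = Bi n i ;
  base_spacer : forall n, (0 < sigma n 0)%N -> B n.+1 = Sg n 0%N 1%N ;
  base_part : forall n, sigma n 0 = 0%N -> B n.+1 = Bi n 0%N ;
  levels_generate : forall A, measurable A ->
    exists2 E : set X,
      <<s [set L | exists n k, (k < height n)%N /\ L = Tn k (B n)] >> E &
      mu ((A `\` E) `|` (E `\` A)) = 0%E
}.

End rank_one.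

Definition rank_one (R : realType) d (X : measurableType d)
    (mu : probability X R) (T : automorphism mu) : Prop :=
  exists (q : nat -> nat) (sigma : nat -> nat -> nat),
    [/\ (forall n, 2 <= q n)%N,
        cvgn (series (fun n =>
          (spacers q sigma n)%:R / (height q sigma n.+1)%:R : R)) &
        exists B Bi Sg, tower_structure q sigma T B Bi Sg].

Definition expi (R : realType) (t : R) : R[i] := (cos t +i* sin t)%C.

(* Main.v *)
From HB Require Import structures.
Require Import Defs.
From mathcomp Require Import measurable_realfun zify ring lra.
Import Order.TTheory GRing.Theory Num.Theory numFieldNormedType.Exports.
Set Implicit Arguments.
Unset Strict Implicit.
Unset Printing Implicit Defensive.
Local Open Scope classical_set_scope.
Local Open Scope ring_scope.

(* The rank-one map [T] is built on the space of the universal odometer [S],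
   inside the full group of [S]. After [n] stages both maps permute the same
   [H n] levels, [H n] being the product of the first digit ranges. At stage
   [n], [C n] bounds the time within which every rotation orbit of angle
   [theta] returns [2^-n]-close to [0]. In the [T]-ordering, a block of length
   [L n = H n + C n] is a copy of the old tower with [C n] spacers around it,
   the copy being shifted so that its bottom sits at a height [k] with
   [k * theta] within [2^-n] of an integer: this makes the phases
   [theta * (height in the tower)] converge modulo 1, whence the eigenfunction.
   [H n] consecutive blocks contain [C n * H n] spacers, which are regrouped
   into [C n] further copies of the old [S]-tower; these [L n] copies are put
   next to each other in the [S]-ordering. Hence the two orderings agree up to
   [L n * H n], which is at most [2 (H n)^2], while only a proportion of at most
   [(C n + 1) / H n] of the space is concerned by the new displacements. As
   [H n] can be taken arbitrarily large with respect to [C n], the cocycles are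
   integrable for [t^(1/3)]. The digit ranges of [S] are multiples of [n!], so
   [S] is a universal odometer, conjugate to all the others. *)

(** * Positions in a mixed radix system *)

Local Open Scope nat_scope.

(** The parameters are chosen in the order [C], [m], shifts. A return time [C n] depends only on
    [theta] and [n], because it serves all starting phases at once; this is what allows [m n] to be
    fixed afterwards, so large that [H n.+1] exceeds the cube of [2 ^ n.+1 * (C n.+1).+1]. The shift
    of each copy is chosen last, when the heights are known. The exponent 1/3 is the price of the
    regrouping: a displacement of order [H^2] on a set of measure of order [C / H] contributes about
    [H^(2/3) * C / H = C / H^(1/3)], and the cube above turns this into a multiple of [2^-n]. The
    points with infinitely many spacer digits form a null set by Borel-Cantelli, and [T] fixes them.
    For all other points, any given power of [S] or [T] takes place inside a tower of finite rank,
    so orbits, cocycles and phases reduce to arithmetic on integers below [H n]. *)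

Lemma modSn_mod a d : (a %% d).+1 %% d = a.+1 %% d.
Proof. by rewrite -addn1 modnDml addn1. Qed.

Section positions.
Variable q : nat -> nat.
Hypothesis q_gt1 : forall n, 1 < q n.

Definition radix n := \prod_(i < n) q i.

Lemma radix0 : radix 0 = 1.
Proof. by rewrite /radix big_ord0. Qed.

Lemma radixS n : radix n.+1 = radix n * q n.
Proof. by rewrite /radix big_ord_recr. Qed.

Lemma radix_gt0 n : 0 < radix n.
Proof. by elim: n => [|n IH]; rewrite ?radix0 // radixS muln_gt0 IH ltnW. Qed.

Lemma radix_gt n : n < radix n.
Proof.
elim: n => [|n IH]; rewrite ?radix0 // radixS.
by have := q_gt1 n; have := leq_mul IH (q_gt1 n); lia.
Qed.

Lemma radix_dvd m n : m <= n -> radix m %| radix n.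
Proof.
move=> /subnKC <-; elim: (n - m) => [|k IH]; first by rewrite addn0.
by rewrite addnS radixS dvdn_mulr.
Qed.

Lemma Zp_castq n : (Zp_trunc (q n)).+2 = q n.
Proof. by rewrite Zp_cast. Qed.

Lemma digit_lt (x : digits q) n : (x n : nat) < q n.
Proof. by rewrite -[X in _ < X]Zp_castq ltn_ord. Qed.

(** The first digit is the least significant one, so [pos x n] counts the odometer steps from the
    zero prefix of length [n]. *)
Fixpoint pos (x : digits q) n : nat :=
  if n is m.+1 then pos x m + x m * radix m else 0.

Lemma pos_lt (x : digits q) n : pos x n < radix n.
Proof.
elim: n => [|n IH]; first by rewrite radix0.
by rewrite radixS /=; have := digit_lt x n; nia.
Qed.

Lemma pos_mod (x : digits q) m n : m <= n -> pos x n %% radix m = pos x m.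
Proof.
move=> /subnKC <-; elim: (n - m) => [|k IH].
  by rewrite addn0 modn_small// pos_lt.
rewrite addnS /= -modnDmr -modnMmr.
have /eqP -> : radix (m + k) %% radix m == 0 by apply: radix_dvd; rewrite leq_addr.
by rewrite muln0 mod0n addn0.
Qed.

Lemma pos_div (x : digits q) n : pos x n.+1 %/ radix n = x n.
Proof. by rewrite /= addnC divnMDl ?radix_gt0// divn_small ?addn0// pos_lt. Qed.

Lemma pos_inj (x y : digits q) n : pos x n = pos y n -> forall i, i < n -> x i = y i.
Proof.
move=> exy i lin; apply/val_inj.
by rewrite /= -(pos_div x i) -(pos_div y i) -(pos_mod x lin) -(pos_mod y lin) exy.
Qed.

Lemma eq_pos (x y : digits q) n : (forall i, i < n -> x i = y i) -> pos x n = pos y n.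
Proof.
elim: n => //= n IH exy; rewrite exy// IH// => i lin; apply: exy.
exact: leq_trans lin _.
Qed.

Lemma pos_ext (x y : digits q) : (forall n, pos x n = pos y n) -> x = y.
Proof.
by move=> exy; apply: functional_extensionality_dep => i; apply: (@pos_inj x y i.+1).
Qed.

Definition digits_of (c : nat -> nat) : digits q :=
  fun i => inord (c i).

Lemma digits_ofE c i : c i < q i -> (digits_of c i : nat) = c i.
Proof. by move=> h; rewrite /digits_of inordK// Zp_castq. Qed.

(** The digit space is the inverse limit of the integers modulo [radix n]: a compatible sequence of
    residues [r] comes from a point. Completeness and the change of base both rest on this. *)
Lemma pos_digits_of (r : nat -> nat) : (forall n, r n < radix n) ->
  (forall n, r n.+1 %% radix n = r n) ->
  forall n, pos (digits_of (fun i => r i.+1 %/ radix i)) n = r n.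
Proof.
move=> rlt rmod; elim=> [|n IH] /=; first by have := rlt 0; rewrite radix0; case: (r 0).
have h : r n.+1 %/ radix n < q n by rewrite ltn_divLR ?radix_gt0// mulnC -radixS.
by rewrite IH digits_ofE// [RHS](divn_eq _ (radix n)) rmod addnC.
Qed.

(** The elementary move inside an orbit: the position at rank [n] becomes [k] and the tail is
    kept. *)
Definition place n k (x : digits q) : digits q :=
  fun i => if i < n then digits_of (fun i => k %/ radix i %% q i) i else x i.

Lemma place_tail n k x i : n <= i -> place n k x i = x i.
Proof. by rewrite /place ltnNge => ->. Qed.

Lemma pos_place n k x : k < radix n -> pos (place n k x) n = k.
Proof.
move=> kn; suff H m : m <= n -> pos (place n k x) m = k %% radix m.
  by rewrite H// modn_small.
elim: m => [|m IH] mn /=; first by rewrite radix0 modn1.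
rewrite IH ?(ltnW mn)// /place mn digits_ofE ?ltn_pmod ?(ltnW (q_gt1 m))//.
rewrite radixS modn_divl [in RHS](divn_eq (k %% _) (radix m)) addnC mulnC.
by rewrite (mulnC (q m)) modn_dvdm ?dvdn_mulr// (mulnC (radix m)).
Qed.

Lemma pos_tail_inj (x y : digits q) n : pos x n = pos y n ->
  (forall i, n <= i -> x i = y i) -> x = y.
Proof.
move=> e t; apply: functional_extensionality_dep => i.
by case: (leqP n i) => ?; [exact: t|exact: (pos_inj e)].
Qed.

Lemma succ_digit n (a : 'Z_(q n)) : ((a + 1)%R : nat) = a.+1 %% q n.
Proof.
suff -> : ((a + 1)%R : nat) = a.+1 %% (Zp_trunc (q n)).+2.
  by move: (nat_of_ord a) => k; rewrite Zp_castq.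
by rewrite /= -[in RHS]addn1 modnDmr.
Qed.

Lemma pred_digit n (a : 'Z_(q n)) : ((a - 1)%R : nat) = (a + (q n).-1) %% q n.
Proof.
suff -> : ((a - 1)%R : nat) = (a + (Zp_trunc (q n)).+1) %% (Zp_trunc (q n)).+2.
  by move: (nat_of_ord a) => k; rewrite -(Zp_castq n).
by rewrite /= modnDmr [1 %% _]modn_small// subn1.
Qed.

Lemma pos_max (x : digits q) n :
  [forall i : 'I_n, (x i).+1 == q i] = ((pos x n).+1 == radix n).
Proof.
elim: n => [|n IH].
  by rewrite radix0 eqxx; apply/forallP; case.
have -> : [forall i : 'I_n.+1, (x i).+1 == q i] =
   [forall i : 'I_n, (x i).+1 == q i] && ((x n).+1 == q n).
  apply/forallP/andP => [h|[/forallP h hn] i].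
    split; last exact: (h ord_max).
    by apply/forallP => i; have := h (widen_ord (leqnSn n) i).
  have := ltn_ord i; rewrite ltnS leq_eqVlt => /orP[/eqP ->//|lin].
  exact: (h (Ordinal lin)).
rewrite IH radixS /=; have := pos_lt x n; have := digit_lt x n.
move=> h1 h2; apply/andP/eqP => [[/eqP a /eqP b]|e].
  by move: (nat_of_ord (x n)) a b => k <- <-; rewrite mulnS mulnC; lia.
suff e1 : (x n).+1 = q n.
  by split; apply/eqP => //; move: (nat_of_ord (x n)) e1 e => k <-; rewrite mulnS mulnC; lia.
by move: (nat_of_ord (x n)) h2 e => k; nia.
Qed.

Lemma pos_odometer (x : digits q) n :
  pos (odometer x) n = (pos x n).+1 %% radix n.
Proof.
elim: n => [|n IH] /=; first by rewrite radix0 modn1.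
rewrite IH /odometer pos_max radixS.
have h1 := pos_lt x n; have h2 := digit_lt x n.
have lt1 : (pos x n).+1 + x n * radix n <= radix n * q n by nia.
case: eqP => [e|ne].
  rewrite e modnn add0n succ_digit -addSn e -mulSn (mulnC (radix n)).
  by rewrite -muln_modl.
rewrite modn_small; last by lia.
by rewrite addSn modn_small//; nia.
Qed.

(** A digit borrows exactly when all the preceding ones are 0, that is, when [pos x n] vanishes. *)
Definition odometer_inv (x : digits q) : digits q := fun n =>
  if pos x n == 0 then (x n - 1)%R else x n.

(** Adding [(radix n).-1] stands for subtracting 1 modulo [radix n], since subtraction on [nat] is
    truncated. *)
Lemma pos_odometer_inv (x : digits q) n :
  pos (odometer_inv x) n = (pos x n + (radix n).-1) %% radix n.
Proof.
elim: n => [|n IH] /=; first by rewrite radix0 modn1.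
rewrite IH /odometer_inv radixS.
have h1 := pos_lt x n; have h2 := digit_lt x n; have h3 := radix_gt0 n.
have h4 : radix n <= radix n * q n by rewrite leq_pmulr// ltnW.
case: eqP => [e|ne].
  rewrite e pred_digit !add0n modn_small ?prednK//.
  rewrite muln_modl (mulnC (radix n)).
  move: (nat_of_ord (x n)) h2 (q_gt1 n) => k kq q1.
  have -> : k * radix n + (q n * radix n).-1 = (k + (q n).-1) * radix n + (radix n).-1.
    by rewrite mulnDl -subn1 -[(q n).-1]subn1 mulnBl; lia.
  move: (k + _) => u; rewrite [in RHS](divn_eq u (q n)) -muln_modl mulnDl -mulnA -addnA modnMDl.
  rewrite [RHS]modn_small 1?addnC//.
  have := @ltn_pmod u (q n) (ltnW q1); nia.
have -> : pos x n + (radix n).-1 = (pos x n).-1 + radix n by lia.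
rewrite modnDr modn_small; last by lia.
have -> : pos x n + x n * radix n + (radix n * q n).-1 =
   (pos x n).-1 + x n * radix n + radix n * q n by lia.
by rewrite modnDr modn_small//; nia.
Qed.

Lemma odometerK : cancel (@odometer q) odometer_inv.
Proof.
move=> x; apply: pos_ext => n; rewrite pos_odometer_inv pos_odometer.
have h := pos_lt x n; rewrite modnDml addSn -addnS prednK ?radix_gt0//.
by rewrite modnDr modn_small.
Qed.

Lemma odometer_invK : cancel odometer_inv (@odometer q).
Proof.
move=> x; apply: pos_ext => n; rewrite pos_odometer pos_odometer_inv.
have h := pos_lt x n; rewrite modSn_mod -addnS prednK ?radix_gt0//.
by rewrite modnDr modn_small.
Qed.

Lemma pos_iter_odometer (x : digits q) n k :
  pos (iter k (@odometer q) x) n = (pos x n + k) %% radix n.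
Proof.
elim: k => [|k IH]; first by rewrite addn0 modn_small// pos_lt.
by rewrite iterS pos_odometer IH modSn_mod addnS.
Qed.

(** Read at rank [k]: since [k < radix q k], [k] steps do not complete a turn modulo [radix q k]. *)
Lemma iter_odometer_neq (x : digits q) k : 0 < k -> iter k (@odometer q) x <> x.
Proof.
move=> k0 /(congr1 (fun y => pos y k)); rewrite pos_iter_odometer.
have := radix_gt k; have := pos_lt x k; move: (pos x k) (radix k) => a b ab kb e.
have [h|h] := leqP b (a + k); last by rewrite modn_small// in e; lia.
move: e; have -> : a + k = (a + k - b) + b by lia.
by rewrite modnDr modn_small; lia.
Qed.

End positions.

(** * The odometer and its invariant measure *)

Local Open Scope ring_scope.

Lemma pushforward_measure d d' (T1 : measurableType d) (T2 : measurableType d')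
    (R : realFieldType) (m : {measure set T1 -> \bar R}) (f : T1 -> T2) :
  measurable_fun setT f ->
  exists nu : {measure set T2 -> \bar R}, forall A, nu A = m (f @^-1` A).
Proof.
by move=> mf; exists (measure_function_pushforward__canonical__measure_function_Measure m mf).
Qed.

Section mass1.
Context d (T : measurableType d) (R : realType).
Variable m : {measure set T -> \bar R}.
Hypothesis m1 : m setT = 1%E.

(** The proof of mass 1 is part of the term, so that the probability structure can be inferred from
    it. *)
Definition measure_of_mass1 (_ : m setT = 1%E) : set T -> \bar R := m.

HB.instance Definition _ := Measure.on (measure_of_mass1 m1).
HB.instance Definition _ :=
  Measure_isProbability.Build _ _ _ (measure_of_mass1 m1) m1.

End mass1.

Lemma pushforward_probability d d' (T1 : measurableType d) (T2 : measurableType d')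
    (R : realType) (m : {measure set T1 -> \bar R}) (f : T1 -> T2) :
  measurable_fun setT f -> m setT = 1%E ->
  exists nu : probability T2 R, forall A, nu A = m (f @^-1` A).
Proof.
move=> mf m1; have [nu nuE] := pushforward_measure m mf.
have nu1 : nu setT = 1%E by rewrite nuE preimage_setT.
by exists (measure_of_mass1 nu1).
Qed.

Lemma measurable_truncn_preimage (R : realType) (c : R) (j : nat) :
  0 < c -> measurable [set x : R | Num.truncn (x * c) = j].
Proof.
move=> c0; case: j => [|j].
  (* [truncn] is 0 on negative reals, so the piece of index 0 is a half-line. *)
  rewrite (_ : [set _ | _] = `]-oo, c^-1[%classic); first exact: measurable_itv.
  apply/seteqP; split=> x /=; rewrite in_itv /= -[c^-1]div1r ltr_pdivlMr// => h.
    by rewrite ltNge; apply/truncn0Pn.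
  by apply/truncn0Pn; rewrite -ltNge.
rewrite (_ : [set _ | _] = `[j.+1%:R / c, j.+2%:R / c[%classic); first exact: measurable_itv.
apply/seteqP; split=> x /=; rewrite in_itv /= ler_pdivrMr// ltr_pdivlMr// => h.
  by rewrite ltNge -!truncn_gt_nat h ltnSn ltnn.
exact: truncn_def.
Qed.

Section odometer_measurability.
Variable q : nat -> nat.
Hypothesis q_gt1 : forall n, (1 < q n)%N.

Lemma measurable_digit n (a : 'Z_(q n)) :
  measurable ([set x : digits q | x n = a] : set (odometer_space q)).
Proof. by apply: sub_sigma_algebra; exists n, a. Qed.

Lemma measurable_pos n (P : set nat) :
  measurable ([set x : digits q | P (pos x n)] : set (odometer_space q)).
Proof.
elim: n P => [|n IH] P /=.
  have [p0|p0] := pselect (P 0%N).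
    by rewrite (_ : [set _ | _] = setT)//; apply/seteqP; split.
  by rewrite (_ : [set _ | _] = set0)//; apply/seteqP; split.
rewrite (_ : [set _ | _] = \bigcup_(a in [set: 'Z_(q n)])
    ([set x : digits q | x n = a] `&`
     [set x : digits q | P (pos x n + a * radix q n)%N])).
  apply: fin_bigcup_measurable; first exact: finite_finset.
  move=> a _; apply: measurableI; first exact: measurable_digit.
  exact: (IH (fun k => P (k + a * radix q n)%N)).
apply/seteqP; split=> [x Px|x [a _ [/= -> //]]].
by exists (x n).
Qed.


Context (R : realType).

Section uniform_measure.
Variable nu : {measure set (odometer_space q) -> \bar R}.
Hypothesis nu_uniform : forall n (a : digits q),
  nu [set x : digits q | forall i, (i < n)%N -> x i = a i]
      = (\prod_(i < n) ((q i)%:R^-1 : R))%:E.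

Lemma uniform_pos n k : (k < radix q n)%N ->
  nu [set x : digits q | pos x n = k] = ((radix q n)%:R^-1)%:E.
Proof.
move=> kn; pose a : digits q := place n k (fun=> 0).
transitivity (nu [set x : digits q | forall i, (i < n)%N -> x i = a i]).
  congr (nu _); apply/seteqP; split=> x /= h.
    by apply: pos_inj => //; rewrite pos_place.
  by rewrite (eq_pos h) pos_place.
by rewrite nu_uniform /radix natr_prod -prodfV.
Qed.

Lemma uniform_pos_set n (P : pred nat) :
  nu [set x : digits q | P (pos x n)] =
  ((\sum_(k < radix q n | P k) 1)%:R / (radix q n)%:R)%:E.
Proof.
have -> : [set x : digits q | P (pos x n)] =
   \big[setU/set0]_(k < radix q n | P k) [set x : digits q | pos x n = k].
  rewrite big_mkcond -(bigcup_mkord _ (fun k =>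
    if P k then [set x : digits q | pos x n = k] else set0)).
  apply/seteqP; split=> [x /= Px|x [k /= _]]; last by case: ifPn => // Pk ->.
  by exists (pos x n); rewrite /= ?Px//; exact: pos_lt.
rewrite (@measure_bigsetU_ord_cond _ _ _ nu _ P
   (fun k : 'I_(radix q n) => [set x : digits q | pos x n = k])); first last.
- by move=> i j _ _ [x [/= e1 e2]]; apply/val_inj; rewrite /= -e1 -e2.
- by move=> i _; exact: (@measurable_pos n [set (i : nat)]).
rewrite (eq_bigr (fun _ => ((radix q n)%:R^-1)%:E)) => [|i _].
  by rewrite sumEFin; congr _%:E; rewrite natr_sum mulr_suml; apply: eq_bigr => ? _; rewrite mul1r.
exact: uniform_pos.
Qed.

Lemma uniform_setT : nu setT = 1%:E.
Proof.
have <- : [set x : digits q | pos x 0 = 0%N] = setT by apply/seteqP; split.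
by rewrite uniform_pos radix0 ?invr1.
Qed.

End uniform_measure.

(** Two cylinders are nested or disjoint; adding the empty set makes the family stable under
    intersection, as uniqueness of measures requires. *)
Definition cylinders : set (set (digits q)) :=
  [set A | A = set0 \/ exists n k, A = [set x : digits q | pos x n = k]].

Lemma measurable_cylinders :
  (@measurable _ (odometer_space q)) = <<s cylinders >>.
Proof.
apply/seteqP; split.
  apply: smallest_sub; first exact: smallest_sigma_algebra.
  move=> _ [n [a ->]].
  rewrite (_ : [set x : digits q | x n = a] =
     \bigcup_(k in [set k | (k %/ radix q n)%N = a]) [set x : digits q | pos x n.+1 = k]).
    apply: (@bigcup_measurable _ (g_sigma_algebraType cylinders)) => k _.
    by apply: sub_sigma_algebra; right; exists n.+1, k.
  apply/seteqP; split=> [x /= <-|x [k /= ka xk]].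
    by exists (pos x n.+1) => //=; rewrite pos_div.
  by apply/ord_inj; rewrite -(pos_div q_gt1) -ka -xk.
apply: smallest_sub; first exact: smallest_sigma_algebra.
move=> A [->|[n [k ->]]]; first exact: measurable0.
exact: (@measurable_pos n [set k]).
Qed.

Lemma cylinders_setI : setI_closed cylinders.
Proof.
move=> A B [->|[n [k ->]]]; first by move=> _; left; rewrite set0I.
move=> [->|[m [l ->]]]; first by left; rewrite setI0.
wlog nm : n k m l / (n <= m)%N.
  move=> H; have [|] := leqP n m; first exact: H.
  by move=> /ltnW mn; rewrite setIC; exact: H.
have [e|ne] := eqVneq (l %% radix q n)%N k.
  right; exists m, l; apply/seteqP; split=> [x []//|x /= xl]; split => //=.
  by rewrite -(pos_mod q_gt1 x nm) xl.
left; apply/seteqP; split=> // x [/= e1 e2].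
by case/eqP: ne; rewrite -e2 pos_mod.
Qed.

Lemma measure_ext_pos (m1 m2 : {measure set (odometer_space q) -> \bar R}) :
  (m1 setT < +oo)%E ->
  (forall n k, m1 [set x : digits q | pos x n = k] = m2 [set x : digits q | pos x n = k]) ->
  forall A, measurable A -> m1 A = m2 A.
Proof.
move=> m1oo m12 A mA.
apply: (@measure_unique _ R (odometer_space q) cylinders (fun=> setT)) => //.
- exact: measurable_cylinders.
- exact: cylinders_setI.
- by move=> _; right; exists 0%N, 0%N; apply/seteqP; split.
- by rewrite bigcup_const.
- by move=> _ [->|[n [k ->]]]; rewrite ?measure0.
Qed.

Lemma pos_ge_set0 n k : (radix q n <= k)%N -> [set x : digits q | pos x n = k] = set0.
Proof.
move=> nk; apply/seteqP; split=> // x /= e.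
by have := pos_lt q_gt1 x n; rewrite e ltnNge nk.
Qed.

Lemma uniform_ext (m1 m2 : {measure set (odometer_space q) -> \bar R}) :
  (forall n k, (k < radix q n)%N ->
    m1 [set x : digits q | pos x n = k] = ((radix q n)%:R^-1)%:E) ->
  (forall n k, (k < radix q n)%N ->
    m2 [set x : digits q | pos x n = k] = ((radix q n)%:R^-1)%:E) ->
  forall A, measurable A -> m1 A = m2 A.
Proof.
move=> u1 u2; apply: measure_ext_pos => [|n k].
  have <- : [set x : digits q | pos x 0 = 0%N] = setT by apply/seteqP; split.
  by rewrite u1 radix0// ltry.
have [kn|kn] := ltnP k (radix q n); first by rewrite u1 ?u2.
by rewrite pos_ge_set0// !measure0.
Qed.

Lemma measurable_fun_odometer_space d (T : measurableType d) (f : T -> odometer_space q) :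
  (forall n k, measurable (f @^-1` [set x : digits q | pos x n = k])) ->
  measurable_fun setT f.
Proof.
move=> mf; apply: (@measurability _ _ T (odometer_space q) setT f cylinders) => //.
  exact: measurable_cylinders.
move=> _ [_ [->|[n [k ->]]] <-]; first by rewrite preimage_set0 setI0.
by rewrite setTI.
Qed.


Lemma measurable_odometer :
  measurable_fun setT (@odometer q : odometer_space q -> odometer_space q).
Proof.
apply: measurable_fun_odometer_space => n k.
rewrite (_ : _ @^-1` _ = [set x : digits q | [set j | (j.+1 %% radix q n)%N = k] (pos x n)]).
  exact: measurable_pos.
by apply/seteqP; split=> x /=; rewrite pos_odometer.
Qed.

Lemma measurable_odometer_inv :
  measurable_fun setT (@odometer_inv q : odometer_space q -> odometer_space q).
Proof.
apply: measurable_fun_odometer_space => n k.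
rewrite (_ : _ @^-1` _ = [set x : digits q |
    [set j | ((j + (radix q n).-1) %% radix q n)%N = k] (pos x n)]).
  exact: measurable_pos.
by apply/seteqP; split=> x /=; rewrite pos_odometer_inv.
Qed.

Lemma pos_odometer_preimage n k : (k < radix q n)%N ->
  @odometer q @^-1` [set x : digits q | pos x n = k] =
  [set x : digits q | pos x n = ((k + (radix q n).-1) %% radix q n)%N].
Proof.
move=> kn; have r0 := radix_gt0 q_gt1 n.
apply/seteqP; split=> x /=; rewrite pos_odometer// => e.
  rewrite -e modnDml addSn -addnS prednK// modnDr modn_small//.
  exact: pos_lt.
by rewrite e modSn_mod -addnS prednK// modnDr modn_small.
Qed.

Lemma odometer_preserves (nu : probability (odometer_space q) R) :
  is_uniform_product nu ->
  forall A : set (odometer_space q), measurable A ->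
    pushforward nu (@odometer q : odometer_space q -> odometer_space q) A = nu A.
Proof.
move=> nuq A mA.
have [m mE] := pushforward_measure nu measurable_odometer.
rewrite -[LHS]mE; apply: uniform_ext mA => n k kn; last exact: uniform_pos.
by rewrite mE pos_odometer_preimage// uniform_pos// ltn_pmod// radix_gt0.
Qed.

Definition odometer_iso (nu : probability (odometer_space q) R)
    (nuq : is_uniform_product nu) : automorphism nu :=
  @MpIso R _ (odometer_space q) nu _ (odometer_space q) nu (@odometer q)
    (@odometer_inv q) (odometerK q_gt1) (odometer_invK q_gt1) measurable_odometer
    measurable_odometer_inv (odometer_preserves nuq).

Lemma odometer_isoP (nu : probability (odometer_space q) R)
  (nuq : is_uniform_product nu) : is_odometer (odometer_iso nuq).
Proof. by []. Qed.

Definition real_digits (x : R) : odometer_space q :=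
  @digits_of q (fun i => (Num.truncn (x * (radix q i.+1)%:R) %% q i)%N).

(* The first digits of [x] read [x] in the mixed base [q], most significant
   digit first, so a cylinder is an interval of length [1 / radix q n]. *)
Lemma real_digits_cylinder n (a : digits q) : exists2 j : nat, (j < radix q n)%N &
  forall x : R, 0 <= x < 1 ->
    (forall i, (i < n)%N -> real_digits x i = a i) <->
    (j%:R / (radix q n)%:R <= x < j.+1%:R / (radix q n)%:R).
Proof.
have r0 k : 0 < (radix q k)%:R :> R by rewrite ltr0n radix_gt0.
suff [j jn jP] : exists2 j : nat, (j < radix q n)%N & forall x : R, 0 <= x < 1 ->
    (forall i, (i < n)%N -> real_digits x i = a i) <->
    Num.truncn (x * (radix q n)%:R) = j.
  exists j => // x x01; rewrite jP//; case/andP: x01 => x0 _.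
  rewrite ler_pdivrMr// ltr_pdivlMr//.
  have x0' : 0 <= x * (radix q n)%:R by rewrite mulr_ge0// ltW.
  by rewrite -truncn_eq//; split=> /eqP.
elim: n => [|n [j jn IH]].
  exists 0%N; rewrite ?radix0// => x x01; rewrite mulr1.
  by split=> // _; apply: truncn_def.
have qn := digit_lt q_gt1 a n.
exists (j * q n + a n)%N => [|x x01]; first by rewrite radixS; nia.
have trS : (Num.truncn (x * (radix q n.+1)%:R) %/ q n)%N = Num.truncn (x * (radix q n)%:R).
  have x0' k : 0 <= x * (radix q k)%:R by case/andP: x01 => x0 _; rewrite mulr_ge0// ltW.
  apply/esym/eqP; rewrite truncn_eq//.
  have q0 : 0 < (q n)%:R :> R by rewrite ltr0n ltnW.
  have := truncn_itv (x0' n.+1); set k := Num.truncn _.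
  rewrite radixS natrM mulrA => /andP[h1 h2].
  rewrite -(ler_pM2r q0) -(ltr_pM2r q0 (x * _)) -!natrM; apply/andP; split.
    by apply: le_trans h1; rewrite ler_nat leq_trunc_div.
  apply: lt_le_trans h2 _; rewrite ler_nat mulSn addnC.
  by rewrite {1}(divn_eq k (q n)) ltn_add2l ltn_pmod// ltnW.
have dE : (real_digits x n : nat) = (Num.truncn (x * (radix q n.+1)%:R) %% q n)%N.
  by rewrite digits_ofE// ltn_pmod// ltnW.
split=> [h|e].
  rewrite [LHS](divn_eq _ (q n)) trS -dE h//; congr (_ * _ + _)%N.
  by apply/IH => // i lin; apply: h; apply: leq_trans lin _.
move: trS dE; rewrite e divnMDl ?(ltnW (q_gt1 n))// divn_small// addn0 => /esym/IH-/(_ x01) h1.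
rewrite modnMDl modn_small// => h2 i.
by rewrite ltnS leq_eqVlt => /orP[/eqP->|/h1//]; apply/ord_inj.
Qed.

(** The measure is the image of Lebesgue measure on [[0, 1[] under the mixed-base expansion
    [real_digits]. *)
Lemma exists_uniform : exists nu : probability (odometer_space q) R, is_uniform_product nu.
Proof.
have mI : measurable (`[0, 1[%classic : set (measurableTypeR R)) by exact: measurable_itv.
pose m := mrestr (@lebesgue_measure R) mI.
have m1 : m setT = 1%E by rewrite /m /mrestr setTI lebesgue_measure_itv /= lte01 oppr0 adde0.
have mf : measurable_fun setT (real_digits : measurableTypeR R -> odometer_space q).
  apply: (@measurability _ _ (measurableTypeR R) (odometer_space q) setT _
    (@digit_sets q)) => //.
  move=> _ [_ [n [a ->]] <-]; rewrite setTI.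
  rewrite (_ : _ @^-1` _ = \bigcup_(j in [set j | (j %% q n)%N = a])
      [set x : R | Num.truncn (x * (radix q n.+1)%:R) = j]).
    apply: bigcup_measurable => j _; apply: measurable_truncn_preimage.
    by rewrite ltr0n radix_gt0.
  have lt k : (k %% q n < q n)%N by rewrite ltn_pmod// ltnW.
  apply/seteqP; split=> [x /= <-|x [j /= ja xj]].
    by eexists; last by []; rewrite /= digits_ofE.
  by apply/ord_inj; rewrite -ja -xj; apply: digits_ofE.
have [nu nuE] := pushforward_probability mf m1.
exists nu => n a; rewrite nuE.
have [j jn jP] := real_digits_cylinder n a.
have r0 : 0 < (radix q n)%:R :> R by rewrite ltr0n radix_gt0.
transitivity (lebesgue_measure
    (`[j%:R / (radix q n)%:R, j.+1%:R / (radix q n)%:R[%classic : set R)).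
  congr (lebesgue_measure _); apply/seteqP; split=> x /=.
    by move=> [h]; rewrite !in_itv /= => x01; apply/jP.
  rewrite !in_itv /= => xj; have x01 : 0 <= x < 1; last by split => //; apply/jP.
  case/andP: xj => h1 h2; apply/andP; split.
    by apply: le_trans h1; rewrite divr_ge0.
  by apply: lt_le_trans h2 _; rewrite ler_pdivrMr// mul1r ler_nat.
rewrite lebesgue_measure_itv /= lte_fin ltr_pM2r ?invr_gt0// ltr_nat ltnSn.
rewrite -EFinD -mulrBl -natrB// subSnn mul1r /radix natr_prod; congr _%:E.
by rewrite -prodfV.
Qed.

End odometer_measurability.

(** * Odometer spaces are standard and atomless *)

Local Open Scope ring_scope.

Definition adic (R : realType) (q : nat -> nat) : Type := digits q.

Section adic_metric.
Variables (R : realType) (q : nat -> nat).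

HB.instance Definition _ := Pointed.copy (adic R q) (digits q).

(** The ultrametric whose ball of radius [1 / (n + 1)] is the cylinder of rank [n]. The condition
    [0 < e] keeps the triangle inequality true: it makes [e1 + e2] dominate both radii. *)
Definition adic_ball (x : adic R q) (e : R) (y : adic R q) : Prop :=
  0 < e /\ forall n, e * n.+1%:R <= 1 -> pos x n = pos y n.

Let ball_center x (e : R) : 0 < e -> adic_ball x e x.
Proof. by []. Qed.

Let ball_sym x y (e : R) : adic_ball x e y -> adic_ball y e x.
Proof. by move=> [e0 h]; split=> // n /h. Qed.

Let ball_triangle x y z e1 e2 :
  adic_ball x e1 y -> adic_ball y e2 z -> adic_ball x (e1 + e2) z.
Proof.
move=> [e10 h1] [e20 h2]; split=> [|n]; first exact: addr_gt0.
rewrite mulrDl => h; have n0 : 0 < n.+1%:R :> R by rewrite ltr0n.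
by rewrite h1 ?h2//; apply: le_trans h; rewrite ?lerDl ?lerDr mulr_ge0// ltW.
Qed.

HB.instance Definition _ := hasNbhs.Build (adic R q) (nbhs_ (entourage_ adic_ball)).

HB.instance Definition _ := @Nbhs_isPseudoMetric.Build R (adic R q)
  (entourage_ adic_ball) erefl adic_ball ball_center ball_sym ball_triangle erefl.

Hypothesis q_gt1 : forall n, (1 < q n)%N.

Lemma adic_ball_pos (x y : adic R q) n :
  ball x (n.+1%:R^-1) y <-> pos x n = pos y n.
Proof.
have n0 : 0 < n.+1%:R :> R by rewrite ltr0n.
split=> [[_ h]|xy]; first by apply: h; rewrite mulVf// gt_eqF.
split=> [|m]; first by rewrite invr_gt0.
rewrite ler_pdivrMl// mulr1 ler_nat ltnS => mn.
by rewrite -(pos_mod q_gt1 x mn) -(pos_mod q_gt1 y mn) xy.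
Qed.

Lemma nbhs_adicP (x : adic R q) (A : set (adic R q)) :
  nbhs x A <-> exists n, [set y : adic R q | pos x n = pos y n] `<=` A.
Proof.
split=> [/nbhs_ballP[e /= e0 xA]|[n xA]].
  exists (Num.truncn e^-1) => y /= xy; apply: xA; split=> // m em.
  have mn : (m <= Num.truncn e^-1)%N.
    rewrite -ltnS -(ltr_nat R); apply: le_lt_trans (real_truncnS_gt _); last exact: num_real.
    rewrite -[e^-1]mul1r ler_pdivlMr// mulrC; apply: le_trans em.
    by rewrite ler_pM2l// ler_nat.
  by rewrite -(pos_mod q_gt1 x mn) -(pos_mod q_gt1 y mn) xy.
apply/nbhs_ballP; exists n.+1%:R^-1 => /=; first by rewrite invr_gt0 ltr0n.
by move=> y /adic_ball_pos; exact: xA.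
Qed.

(** A Cauchy filter contains one cylinder of each rank. Two members of a proper filter meet, so the
    positions of these cylinders are compatible and [pos_digits_of] glues them into the limit. *)
Lemma adic_complete (F : set_system (adic R q)) : ProperFilter F -> cauchy F -> cvg F.
Proof.
move=> PF /cauchyP FC.
have cE : forall n, exists x : digits q, F [set y : adic R q | pos x n = pos y n].
  move=> n; have [|x Fx] := FC (n.+1%:R^-1); first by rewrite invr_gt0 ltr0n.
  by exists x; apply: filterS Fx => y /adic_ball_pos.
have [c cP] := boolp.choice cE.
pose r n := pos (c n) n.
have rmod n : (r n.+1 %% radix q n)%N = r n.
  have [y [y1 y2]] := filter_ex (filterI (cP n.+1) (cP n)).
  have e1 : pos (c n.+1) n.+1 = pos y n.+1 := y1.
  have e2 : pos (c n) n = pos y n := y2.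
  by rewrite /r e1 e2 pos_mod.
have rlt n : (r n < radix q n)%N by apply: pos_lt.
pose x : adic R q := @digits_of q (fun i => (r i.+1 %/ radix q i)%N).
apply/cvg_ex; exists x => A /nbhs_adicP[n nA].
apply: filterS (cP n) => y /= e; apply: nA => /=.
by rewrite /x pos_digits_of.
Qed.

Lemma open_pos n k : open [set y : adic R q | pos y n = k].
Proof.
rewrite openE => x /= xk; apply/nbhs_adicP; exists n => y /= <-; exact: xk.
Qed.

Lemma adic_second_countable : @second_countable (adic R q).
Proof.
exists (range (fun nk : nat * nat => [set y : adic R q | pos y nk.1 = nk.2])).
  exact: (sub_countable (card_image_le _ _)) (countableP _).
split=> [_ [[n k] _ <-]|x A /nbhs_adicP[n nA]]; first exact: open_pos.
exists [set y : adic R q | pos y n = pos x n].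
  by split => //; exists (n, pos x n).
by move=> y /= e; apply: nA.
Qed.

Lemma adic_hausdorff : hausdorff_space (adic R q).
Proof.
move=> x y xy; apply: (@pos_ext q q_gt1) => n.
have [] := xy [set z : adic R q | pos x n = pos z n] [set z : adic R q | pos y n = pos z n].
- by apply/nbhs_adicP; exists n.
- by apply/nbhs_adicP; exists n.
by move=> z /= [-> ->].
Qed.

End adic_metric.

Lemma standard_borel_odometer (R : realType) (q : nat -> nat) :
  (forall n, (1 < q n)%N) -> standard_borel R (odometer_space q).
Proof.
move=> q_gt1.
pose P : completePseudoMetricType R :=
  HB.pack (adic R q) (Uniform_isComplete.Build (adic R q) (@adic_complete R q q_gt1)).
exists P, id; split.
- exact: adic_hausdorff.
- exact: adic_second_countable.
- by exists id.
move=> A; rewrite image_id; split.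
  move: A; apply: smallest_sub; first exact: smallest_sigma_algebra.
  move=> _ [n [a ->]]; apply: sub_sigma_algebra.
  rewrite openE => x /= xa; apply/(nbhs_adicP q_gt1); exists n.+1 => y /= xy.
  by rewrite -xa; apply/esym; apply: (@pos_inj q q_gt1 x y n.+1 xy).
move: A; apply: smallest_sub; first exact: smallest_sigma_algebra.
move=> A; rewrite openE => Ao.
(* An open set is the union of the cylinders it contains, and there are only countably many
   cylinders. *)
pose I := [set nk : nat * nat | [set y : digits q | pos y nk.1 = nk.2] `<=` A].
rewrite (_ : A = \bigcup_(nk in I) [set y : digits q | pos y nk.1 = nk.2]).
  rewrite bigcup_mkcond.
  apply: (@countable_bigcupT_measurable _ (odometer_space q)) => // nk.
  by case: ifP => // _; exact: (measurable_pos nk.1 [set nk.2]).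
apply/seteqP; split=> [x Ax|x [nk nkA]]; last exact: nkA.
have /(nbhs_adicP q_gt1)[n nA] := Ao x Ax.
by exists (n, pos x n) => // y /= e; apply: nA.
Qed.

(** At a rank where cylinders have measure less than [nu A], some cylinder meets [A] in positive
    measure, otherwise [A] would be null; that intersection is the smaller piece. *)
Lemma atomless_odometer (R : realType) (q : nat -> nat)
    (nu : probability (odometer_space q) R) :
  (forall n, (1 < q n)%N) -> is_uniform_product nu -> atomless nu.
Proof.
move=> q_gt1 nuq A mA A0.
have [n nA] : exists n, ((radix q n)%:R^-1%:E < nu A)%E.
  have Afin : nu A \is a fin_num by exact: fin_num_measure.
  move: A0; rewrite -(fineK Afin) lte_fin; set r := fine _ => r0.
  exists (Num.truncn r^-1); rewrite lte_fin -[ltRHS]invrK.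
  rewrite ltf_pV2 ?posrE ?invr_gt0 ?ltr0n ?radix_gt0//.
  apply: lt_le_trans (real_truncnS_gt _) _; first exact: num_real.
  by rewrite ler_nat; exact: radix_gt.
have [[k B0]|] := pselect (exists k, (0 < nu (A `&` [set x : digits q | pos x n = k]))%E).
  exists (A `&` [set x : digits q | pos x n = k]); split => //.
  - by apply: measurableI => //; exact: (measurable_pos n [set k]).
  - apply: le_lt_trans nA.
    have [kn|kn] := ltnP k (radix q n).
      rewrite -(uniform_pos q_gt1 nuq kn); apply: le_measure; rewrite ?inE//.
        by apply: measurableI => //; exact: (measurable_pos n [set k]).
      exact: (measurable_pos n [set k]).
    by rewrite pos_ge_set0// setI0 measure0 lee_fin invr_ge0.
move=> /forallNP h; exfalso; move: A0.
suff -> : nu A = 0%E by rewrite ltxx.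
rewrite [X in nu X](_ : A = \bigcup_k (A `&` [set x : digits q | pos x n = k])).
  rewrite measure_bigcup//=.
  - apply: eseries0 => k _ _; apply/eqP; rewrite eq_le measure_ge0 andbT leNgt.
    exact/negP.
  - by move=> k _; apply: measurableI => //; exact: (measurable_pos n [set k]).
  - by move=> i j _ _ [x [[_ /= <-] [_ /= <-]]].
apply/seteqP; split=> [x Ax|x [k _ []//]].
by exists (pos x n).
Qed.

(** * Universal odometers are conjugate *)

Local Open Scope nat_scope.

Lemma count_mod a D (P : pred nat) :
  \sum_(j < a * D | P (j %% D)) 1 = a * \sum_(j < D | P j) 1.
Proof.
rewrite -(big_mkord (fun j => P (j %% D)) (fun=> 1)).
elim: a => [|a IH]; first by rewrite !mul0n big_geq.
rewrite (@big_cat_nat _ _ _ (a * D)) ?leq_mul//= IH !mulSnr; congr addn.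
rewrite -{1}[a * D]add0n [_ + D]addnC big_addn addnK big_mkord.
apply: eq_bigl => j /=; by rewrite addnC modnMDl modn_small.
Qed.

Lemma logn_radix q p n : (forall n, 1 < q n) ->
  logn p (radix q n) = \sum_(i < n) logn p (q i).
Proof.
move=> q_gt1; elim: n => [|n IH]; first by rewrite radix0 logn1 big_ord0.
by rewrite radixS lognM ?radix_gt0// ?IH ?big_ord_recr// ltnW.
Qed.

(** Universality provides, for each prime, a rank where its exponent in [D] is reached; primes
    dividing [D] are at most [D], so a maximum over finitely many ranks suffices. *)
Lemma universal_dvd q D : universal_seq q -> 0 < D -> exists m, D %| radix q m.
Proof.
move=> [q_gt1 qu] D0.
have ex p : exists m, prime p -> logn p D <= logn p (radix q m).
  have [pp|] := boolP (prime p); last by exists 0.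
  by have [m mP] := qu p pp (logn p D); exists m => _; rewrite logn_radix.
have [f fP] := boolp.choice ex.
exists (\max_(p < D.+1) f p); apply/(dvdn_partP _ D0) => p pD.
have pp : prime p by move: pD; rewrite mem_primes => /and3P[].
have pD1 : p < D.+1.
  by rewrite ltnS; move: pD; rewrite mem_primes => /and3P[_ _ /dvdn_leq]; exact.
rewrite p_part pfactor_dvdn ?radix_gt0//.
apply: leq_trans (fP p pp) _; apply: dvdn_leq_log; first exact: radix_gt0.
by apply: radix_dvd; exact: (@leq_bigmax _ (fun i : 'I_D.+1 => f i) (Ordinal pD1)).
Qed.

Lemma pos_mod_dvd q (q_gt1 : forall n, 1 < q n) (x : digits q) D m m' :
  D %| radix q m -> D %| radix q m' -> pos x m %% D = pos x m' %% D.
Proof.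
wlog mm' : m m' / m <= m'.
  move=> H h h'; have [?|/ltnW ?] := leqP m m'; first exact: H.
  by apply/esym; exact: H.
by move=> h _; rewrite -(pos_mod q_gt1 x mm') modn_dvdm.
Qed.

Section conjugacy.
Variables q r : nat -> nat.
Hypotheses (q_univ : universal_seq q) (r_univ : universal_seq r).

Let q_gt1 : forall n, 1 < q n. Proof. by case: q_univ. Qed.
Let r_gt1 : forall n, 1 < r n. Proof. by case: r_univ. Qed.

Let depth n : nat := projT1 (cid (universal_dvd q_univ (radix_gt0 r_gt1 n))).

Let depth_dvd n : radix r n %| radix q (depth n).
Proof. by rewrite /depth; case: cid. Qed.

(** The identity of the profinite integers, rewritten from base [q] to base [r]: the residue modulo
    [radix r i] is read at a rank of [q] whose radix is a multiple of it. *)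
Definition rebase (x : digits q) : digits r :=
  digits_of r (fun i => (pos x (depth i.+1) %% radix r i.+1) %/ radix r i).

Lemma pos_rebase (x : digits q) n m : radix r n %| radix q m ->
  pos (rebase x) n = pos x m %% radix r n.
Proof.
move=> nm; rewrite (pos_mod_dvd q_gt1 x nm (depth_dvd n)) /rebase.
rewrite (@pos_digits_of r r_gt1 (fun i => pos x (depth i) %% radix r i))// => i.
  by rewrite ltn_pmod// radix_gt0.
rewrite modn_dvdm ?radix_dvd//; apply: (pos_mod_dvd q_gt1) => //.
by apply: dvdn_trans (depth_dvd _); exact: radix_dvd.
Qed.

Lemma rebase_odometer (x : digits q) : rebase (odometer x) = odometer (rebase x).
Proof.
apply: (pos_ext r_gt1) => n; have nm := depth_dvd n.
rewrite (pos_odometer r_gt1) !(pos_rebase _ nm) (pos_odometer q_gt1) modn_dvdm//.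
by rewrite modSn_mod.
Qed.

Lemma measurable_rebase :
  measurable_fun setT (rebase : odometer_space q -> odometer_space r).
Proof.
apply: (measurable_fun_odometer_space r_gt1) => n k.
rewrite (_ : _ @^-1` _ = [set x : digits q |
    [set j | j %% radix r n = k] (pos x (depth n))]).
  exact: measurable_pos.
by apply/seteqP; split=> x /=; rewrite (pos_rebase _ (depth_dvd n)).
Qed.

Lemma rebase_preserves (R : realType) (nu : probability (odometer_space q) R)
    (mu : probability (odometer_space r) R) :
  is_uniform_product nu -> is_uniform_product mu ->
  forall A : set (odometer_space r), measurable A ->
  pushforward nu (rebase : odometer_space q -> odometer_space r) A = mu A.
Proof.
move=> nuq mur A mA; have [m mE] := pushforward_measure nu measurable_rebase.
rewrite -[LHS]mE; apply: (uniform_ext r_gt1) mA => n k kn; last exact: uniform_pos.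
rewrite mE (_ : _ @^-1` _ = [set x : digits q | pos x (depth n) %% radix r n == k]).
  rewrite (uniform_pos_set q_gt1 nuq _ (fun j => j %% radix r n == k)).
  (* A cylinder of rank [n] in base [r] pulls back to [a] cylinders of rank [depth n] in base
     [q]. *)
  have /dvdnP[a ae] := depth_dvd n.
  have a0 : 0 < a by have := radix_gt0 q_gt1 (depth n); rewrite ae muln_gt0 => /andP[].
  have -> : \sum_(j < radix q (depth n) | j %% radix r n == k) 1 = a.
    rewrite ae (count_mod _ _ (fun j => j == k)).
    by rewrite (big_pred1 (Ordinal kn)) ?muln1// => i; rewrite -val_eqE.
  by rewrite ae natrM invfM mulrA mulfV ?mul1r// pnatr_eq0; lia.
by apply/seteqP; split=> x /=; rewrite (pos_rebase _ (depth_dvd n)) => /eqP.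
Qed.

End conjugacy.

Lemma rebaseK q r (q_univ : universal_seq q) (r_univ : universal_seq r) :
  cancel (@rebase q r q_univ r_univ) (@rebase r q r_univ q_univ).
Proof.
have q_gt1 : forall n, 1 < q n by case: q_univ.
have r_gt1 : forall n, 1 < r n by case: r_univ.
move=> x; apply: (pos_ext q_gt1) => n.
have [m nm] := universal_dvd r_univ (radix_gt0 q_gt1 n).
have [l ml] := universal_dvd q_univ (radix_gt0 r_gt1 m).
rewrite (pos_rebase _ _ _ nm) (pos_rebase _ _ _ ml) modn_dvdm//.
rewrite (pos_mod_dvd q_gt1 x (dvdn_trans nm ml) (dvdnn (radix q n))).
by rewrite modn_small// pos_lt.
Qed.

Definition rebase_iso (R : realType) q r (q_univ : universal_seq q) (r_univ : universal_seq r)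
    (nu : probability (odometer_space q) R) (mu : probability (odometer_space r) R)
    (nuq : is_uniform_product nu) (mur : is_uniform_product mu) : mp_iso nu mu :=
  @MpIso R _ (odometer_space q) nu _ (odometer_space r) mu
    (rebase q_univ r_univ) (rebase r_univ q_univ)
    (rebaseK q_univ r_univ) (rebaseK r_univ q_univ)
    (measurable_rebase q_univ r_univ) (measurable_rebase r_univ q_univ)
    (rebase_preserves q_univ r_univ nuq mur).

(** * The ordering of the tower *)

Local Open Scope nat_scope.

Section columns.
Variables (C m : nat -> nat).

(** Tower [k.+1] is made of [m k] independent groups. Each group has [L k * H k] levels, seen as
    [L k] copies of the old tower in the [S]-ordering and as [H k] blocks of length [L k] in the
    [T]-ordering. *)
Fixpoint stage_height n : nat :=
  if n is k.+1 then m k * (stage_height k + C k) * stage_height k else 1.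
Local Notation H := stage_height.

Definition stage_block n := H n + C n.
Local Notation L := stage_block.

Definition stage_radix n := m n * L n.
Local Notation N := stage_radix.

Hypothesis m_gt0 : forall n, 0 < m n.
Hypothesis C_gt1 : forall n, 1 < C n.

Lemma stage_height_gt0 n : 0 < H n.
Proof. by elim: n => //= n IH; rewrite !muln_gt0 m_gt0 addn_gt0 IH. Qed.

Lemma stage_radix_gt1 n : 1 < N n.
Proof.
rewrite /stage_radix /stage_block; have := m_gt0 n.
by have := C_gt1 n; have := stage_height_gt0 n; nia.
Qed.

Lemma stage_heightS n : H n.+1 = N n * H n. Proof. by []. Qed.

Lemma radix_stage n : radix N n = H n.
Proof. by elim: n => [|n IH]; rewrite ?radix0// radixS IH mulnC. Qed.


Lemma stage_block_gt0 n : 0 < L n.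
Proof. by rewrite addn_gt0 stage_height_gt0. Qed.

(* The digits [u * L n + v] with [1 <= v <= H n] are the copies of the old tower,
   the others are made of spacers. Neither [0] nor the maximal digit is a copy, so
   a point whose digits are copies from some rank on never undergoes an infinite
   carry of the odometer, and never stays at an end of the towers. *)
Definition column_digit n d := (0 < d %% L n <= H n).

Local Notation good := column_digit.

(* A spacer digit [d] has [d %% L n] equal to [0] or in [(H n, L n)]; these
   [C n] values are renumbered [0, ..., C n - 1]. *)
Definition spacer_rank n d := if d %% L n == 0 then 0 else d %% L n - H n.

Variable o : nat -> nat -> nat.
Hypothesis o_range : forall n j, 0 < o n j < C n.

(** In group [u], the copy with digit [u * L n + v] is the column of block [u * H n + v - 1]: the
    group has as many blocks as such copies. The variable [o] gives the place of the column inside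
    its block. *)
Definition column_index n d := d %/ L n * H n + (d %% L n).-1.
Definition column_start n d := column_index n d * L n + o n (column_index n d).

(** The [r]-th place of block [j] outside its column. The [H n] levels of the spacer copy of rank
    [r] occupy this place in the [H n] successive blocks of their group, one level per block. *)
Definition skip_column n j r := if r < o n j then r else r + H n.

(* The height, in the [n]-th tower, of the level with odometer position [p]. *)
Fixpoint tower_rank n p : nat :=
  if n is k.+1 then
    let d := p %/ H k in
    if good k d then column_start k d + tower_rank k (p %% H k)
    else let j := d %/ L k * H k + p %% H k in
         j * L k + skip_column k j (spacer_rank k d)
  else 0.
Local Notation tau := tower_rank.

(* The block of length [L k] of the [T]-ordering in which [p] lies. *)
Let blk k p := let d := p %/ H k in
  d %/ L k * H k + if good k d then (d %% L k).-1 else p %% H k.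

Let off k p := let d := p %/ H k in
  if good k d then o k (column_index k d) + tau k (p %% H k)
  else skip_column k (d %/ L k * H k + p %% H k) (spacer_rank k d).

Let tauE k p : tau k.+1 p = blk k p * L k + off k p.
Proof. by rewrite /= /blk /off /column_start /column_index; case: ifP => _; rewrite ?addnA. Qed.

Let blk_div k p : blk k p %/ H k = p %/ H k %/ L k.
Proof.
have h := stage_height_gt0 k; rewrite /blk divnMDl// [X in _ + X]divn_small ?addn0//.
case: ifPn => [/andP[]|_]; first by lia.
by rewrite ltn_pmod.
Qed.

Let spacer_rank_lt n d : ~~ good n d -> spacer_rank n d < C n.
Proof.
rewrite /column_digit /spacer_rank; have := ltn_pmod d (stage_block_gt0 n); have := C_gt1 n.
by rewrite /stage_block; case: eqP; lia.
Qed.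

Let off_lt k p : tau k (p %% H k) < H k -> off k p < L k.
Proof.
move=> h; rewrite /off /stage_block; case: ifPn => [_|/spacer_rank_lt].
  by have := o_range k (column_index k (p %/ H k)); lia.
by rewrite /skip_column; case: ifP; lia.
Qed.

Lemma tower_rank_lt n p : p < H n -> tau n p < H n.
Proof.
elim: n p => [|n IH] p; first by [].
move=> pH; have h := stage_height_gt0 n; have l := stage_block_gt0 n.
have ol : off n p < L n by rewrite off_lt// IH// ltn_pmod.
rewrite tauE stage_heightS; have : blk n p < m n * H n.
  rewrite -ltn_divLR// blk_div ltn_divLR// -/(N n) ltn_divLR//.
by rewrite /stage_radix; nia.
Qed.

(** Both orderings keep each group in place and permute only inside it. This is the source of the
    bound on the cocycles. *)
Lemma tower_rank_div n p : p < H n.+1 -> tau n.+1 p %/ (L n * H n) = p %/ (L n * H n).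
Proof.
move=> pH; have h := stage_height_gt0 n; have l := stage_block_gt0 n.
have ol : off n p < L n by rewrite off_lt// tower_rank_lt// ltn_pmod.
rewrite [in RHS]mulnC !divnMA tauE divnMDl// [off n p %/ _]divn_small// addn0.
by rewrite blk_div.
Qed.

(** Division by [L n] recovers the block and the offset, and the block gives the group. The offset
    tells columns from spacers, as [skip_column] avoids the column. For a column, the block gives
    the digit and the offset the rank in the old tower, where induction applies; for a spacer, the
    block gives [p %% H n] and the offset gives the digit. *)
Lemma tower_rank_inj n p p' : p < H n -> p' < H n -> tau n p = tau n p' -> p = p'.
Proof.
elim: n p p' => [|n IH] p p'; first by rewrite /=; lia.
move=> pH pH'; have h := stage_height_gt0 n; have l := stage_block_gt0 n.
have ol : off n p < L n by rewrite off_lt// tower_rank_lt// ltn_pmod.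
have ol' : off n p' < L n by rewrite off_lt// tower_rank_lt// ltn_pmod.
rewrite !tauE => e.
have eb : blk n p = blk n p'.
  by move: (congr1 (divn^~ (L n)) e); rewrite !divnMDl//
    !(divn_small ol, divn_small ol') !addn0.
have eo : off n p = off n p' by move: e; rewrite eb => /addnI.
have eu : p %/ H n %/ L n = p' %/ H n %/ L n by rewrite -!blk_div eb.
have tl : tau n (p %% H n) < H n by rewrite tower_rank_lt// ltn_pmod.
have tl' : tau n (p' %% H n) < H n by rewrite tower_rank_lt// ltn_pmod.
suff [ev ew] : p %/ H n %% L n = p' %/ H n %% L n /\ p %% H n = p' %% H n.
  by rewrite (divn_eq p (H n)) (divn_eq p' (H n)) ew (divn_eq (p %/ H n) (L n)) eu ev -divn_eq.
move: eb eo; rewrite /blk /off /column_index eu.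
set u := _ %/ L n; set v := _ %% L n; set v' := _ %% L n.
have hv : v < L n by rewrite ltn_pmod.
have hv' : v' < L n by rewrite ltn_pmod.
have hw : p %% H n < H n by rewrite ltn_pmod.
have hw' : p' %% H n < H n by rewrite ltn_pmod.
have rk d : spacer_rank n d = if d %% L n == 0 then 0 else d %% L n - H n by [].
case: ifPn => g; case: ifPn => g' /addnI; move: g g';
  rewrite /column_digit /skip_column ?rk -/v -/v' => g g' eb eo.
- have ev : v = v' by lia.
  by split => //; apply: IH; rewrite ?ltn_pmod//; move: eo; rewrite ev => /addnI.
- by exfalso; move: eo; rewrite eb; case: ifP; lia.
- by exfalso; move: eo; rewrite -eb; case: ifP; lia.
split => //; move: eo; rewrite eb; move: (o n _) (hv) (hv') => k.
by rewrite /stage_block; case: (v =P 0) => ?; case: (v' =P 0) => ?; repeat case: ifP => ?; lia.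
Qed.

(** The strict bounds on [o] leave a spacer below each column and, in the next lemma, one above it:
    a column touches neither end of the next tower. *)
Lemma column_start_gt0 n d : 0 < column_start n d.
Proof. by rewrite /column_start addn_gt0 orbC; case/andP: (o_range n (column_index n d)) => ->. Qed.

Lemma column_start_lt n d : d < N n -> good n d -> column_start n d + H n < H n.+1.
Proof.
move=> dN /andP[v0 vH]; have h := stage_height_gt0 n; have l := stage_block_gt0 n.
have := o_range n (column_index n d).
have um : d %/ L n < m n by rewrite ltn_divLR.
have : column_index n d < m n * H n.
  rewrite /column_index; apply: (@leq_trans ((d %/ L n).+1 * H n)).
    by rewrite mulSn; lia.
  by rewrite leq_mul2r um orbT.
rewrite /column_start stage_heightS /stage_radix -mulnA [L n * H n]mulnC mulnA.
move: (column_index n d) => j jm /andP[_]; move: (o n j) => k kC.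
apply: (@leq_trans (j.+1 * L n)); last by rewrite leq_mul2r jm orbT.
by have LE : L n = H n + C n by []; rewrite mulSn; lia.
Qed.

Lemma column_digit_gt0 n d : good n d -> 0 < d.
Proof. by rewrite /column_digit; case: d => //; rewrite mod0n. Qed.

Lemma column_digit_lt n d : d < N n -> good n d -> d.+1 < N n.
Proof.
move=> dN /andP[v0 vH]; have um : d %/ L n < m n by rewrite ltn_divLR// stage_block_gt0.
rewrite {1}(divn_eq d (L n)) /stage_radix.
apply: (@leq_trans ((d %/ L n).+1 * L n)); last by rewrite leq_mul2r um orbT.
by have LE : L n = H n + C n by []; have := C_gt1 n; rewrite mulSn; lia.
Qed.

Lemma tower_rank_step n p : good n (p %/ H n) ->
  tau n.+1 p = column_start n (p %/ H n) + tau n (p %% H n).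
Proof. by move=> /= ->. Qed.

End columns.

(** * Transformations moving a coordinate by one *)

Local Open Scope nat_scope.

(** The analogue of [iterz] for a bare pair of maps, usable before [T] is known to be an
    automorphism. *)
Definition iter_int (T : Type) (U V : T -> T) (k : int) : T -> T :=
  match k with
  | Posz n => iter n U
  | Negz n => iter n.+1 V
  end.

Section coordinates.
Variables (q : nat -> nat) (good : nat -> nat -> bool).
Hypothesis q_gt1 : forall n, 1 < q n.
Implicit Types (x y : digits q) (al be : nat -> nat -> nat).

(* Both the position for the odometer and the height in the tower are
   coordinates, so [S] and [T] can be treated symmetrically; reversing a
   coordinate exchanges a transformation and its inverse. *)
Record coordinate al (st : nat -> nat -> nat) : Prop := Coordinate {
  crd_lt : forall n p, p < radix q n -> al n p < radix q n ;
  crd_inj : forall n p p', p < radix q n -> p' < radix q n ->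
    al n p = al n p' -> p = p' ;
  crd_step : forall n p, p < radix q n.+1 -> good n (p %/ radix q n) ->
    al n.+1 p = st n (p %/ radix q n) + al n (p %% radix q n) ;
  crd_st_gt0 : forall n d, d < q n -> good n d -> 0 < st n d ;
  crd_st_lt : forall n d, d < q n -> good n d -> st n d + radix q n < radix q n.+1
}.

Definition opposite al n p := radix q n - (al n p).+1.

Lemma opposite_coordinate al st : coordinate al st ->
  coordinate (opposite al) (fun n d => radix q n.+1 - radix q n - st n d).
Proof.
move=> [lt inj step gt0 stlt]; split.
- by move=> n p /lt; rewrite /opposite; lia.
- move=> n p p' pn pn'; rewrite /opposite => e; apply: inj (pn) (pn') _.
  by have := lt _ _ pn; have := lt _ _ pn'; lia.
- move=> n p pn gp; rewrite /opposite step//.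
  have dq : p %/ radix q n < q n by rewrite ltn_divLR ?radix_gt0// mulnC -radixS.
  have := stlt _ _ dq gp; have := lt n (p %% radix q n).
  by rewrite ltn_pmod ?radix_gt0// => /(_ isT); lia.
- by move=> n d dq gd; have := stlt _ _ dq gd; lia.
- by move=> n d dq gd; have := stlt _ _ dq gd; have := gt0 _ _ dq gd; lia.
Qed.

Definition regular n : set (digits q) := [set x | forall i, n <= i -> good i (x i)].

Lemma regularW n m x : n <= m -> regular n x -> regular m x.
Proof. by move=> nm xn i mi; apply: xn; exact: leq_trans mi. Qed.

Definition same_tail n x y := forall i, n <= i -> x i = y i.

Lemma same_tailW n m x y : n <= m -> same_tail n x y -> same_tail m x y.
Proof. by move=> nm xn i mi; apply: xn; exact: leq_trans mi. Qed.

Lemma same_tail_sym n x y : same_tail n x y -> same_tail n y x.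
Proof. by move=> xy i ni; rewrite xy. Qed.

Lemma same_tail_trans n x y z : same_tail n x y -> same_tail n y z -> same_tail n x z.
Proof. by move=> xy yz i ni; rewrite xy// yz. Qed.

Lemma regular_tail n x y : same_tail n x y -> regular n x -> regular n y.
Proof. by move=> xy xn i ni; rewrite -xy//; exact: xn. Qed.

Lemma measurable_regular n :
  measurable (regular n : set (odometer_space q)).
Proof.
rewrite (_ : regular n = \bigcap_(i in [set i | n <= i])
   [set x : digits q | [set p | good i (p %/ radix q i)] (pos x i.+1)]).
  by apply: bigcap_measurable => [|i _]; [exists n => /=|exact: measurable_pos].
by apply/seteqP; split=> x xn i /= ni; have := xn i ni; rewrite /= pos_div.
Qed.

(** * The successor map of one coordinate and its orbits *)

Section coordinate.
Variables (al st : nat -> nat -> nat).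
Hypothesis alP : coordinate al st.

Lemma crd_pos_lt x n : al n (pos x n) < radix q n.
Proof. by apply: (crd_lt alP); exact: pos_lt. Qed.

Lemma crd_pos_step x n : good n (x n) ->
  al n.+1 (pos x n.+1) = st n (x n) + al n (pos x n).
Proof.
move=> gx; rewrite (crd_step alP) ?pos_div// ?pos_lt//.
by rewrite (pos_mod q_gt1)// pos_div.
Qed.

(** Each copy digit adds at least one level below and one above, so both ends of the tower recede
    from a regular point. *)
Lemma crd_grow x n k : regular n x ->
  k <= al (n + k) (pos x (n + k)) /\ al (n + k) (pos x (n + k)) + k < radix q (n + k).
Proof.
move=> xn; elim: k => [|k [IH1 IH2]].
  by rewrite addn0; split=> //; rewrite addn0; exact: crd_pos_lt.
have gx : good (n + k) (x (n + k)) by apply: xn; rewrite leq_addr.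
have dq := digit_lt q_gt1 x (n + k).
rewrite addnS crd_pos_step//.
by have := crd_st_gt0 alP dq gx; have := crd_st_lt alP dq gx; lia.
Qed.

(** From rank [n] on, [x] and [y] have the same digits and gain the same amount [st], so the
    difference of their coordinates is constant. It is stated additively because subtraction on
    [nat] is truncated. *)
Lemma crd_diff x y n m : regular n x -> same_tail n x y -> n <= m ->
  al m (pos y m) + al n (pos x n) = al m (pos x m) + al n (pos y n).
Proof.
move=> xn xy /subnKC <-; elim: (m - n) => [|k IH]; first by rewrite addn0 addnC.
have gx : good (n + k) (x (n + k)) by apply: xn; rewrite leq_addr.
have exy : x (n + k) = y (n + k) by apply: xy; rewrite leq_addr.
rewrite addnS !crd_pos_step -?exy//; lia.
Qed.

Lemma crd_pos_inj x y n : same_tail n x y -> al n (pos x n) = al n (pos y n) -> x = y.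
Proof.
move=> xy e; apply: (pos_tail_inj q_gt1 _ xy).
by apply: (crd_inj alP) e; exact: pos_lt.
Qed.

Definition crd_inv n k : nat :=
  if [pick p : 'I_(radix q n) | al n p == k] is Some p then p else 0.

(** An injective self-map of a finite set is onto, so the search succeeds and its default value 0 is
    never returned. *)
Lemma crd_invP n k : k < radix q n ->
  crd_inv n k < radix q n /\ al n (crd_inv n k) = k.
Proof.
move=> kn; pose f (p : 'I_(radix q n)) := Ordinal (crd_lt alP (ltn_ord p)).
have f_inj : injective f.
  move=> p p' /(congr1 val) /= e; apply/val_inj.
  exact: (crd_inj alP (ltn_ord p) (ltn_ord p') e).
have [g fg gf] := injF_bij f_inj.
rewrite /crd_inv; case: pickP => [p /eqP //|/(_ (g (Ordinal kn)))].
by have /(congr1 val) /= -> := gf (Ordinal kn); rewrite eqxx.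
Qed.

Lemma crd_invK n p : p < radix q n -> crd_inv n (al n p) = p.
Proof.
move=> pn; have [h e] := crd_invP (crd_lt alP pn).
exact: (crd_inj alP h pn e).
Qed.

Definition movable n : set (digits q) :=
  [set x | regular n x /\ (al n (pos x n)).+1 < radix q n].

Lemma movable_ex n x : regular n x -> movable n.+1 x.
Proof.
move=> xn; split; first exact: regularW xn.
by have [_] := crd_grow 1 xn; rewrite addn1 addn1.
Qed.


Definition first_movable x : option nat :=
  if pselect (exists n, `[< movable n x >]) is left h then Some (ex_minn h) else None.

Lemma first_movableP x :
  (exists n, [/\ first_movable x = Some n, movable n x & forall k, movable k x -> n <= k]) \/
  (first_movable x = None /\ forall n, ~ regular n x).
Proof.
rewrite /first_movable; case: pselect => [h|h].
  left; case: ex_minnP => n /asboolP xn nmin; exists n; split=> // k xk.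
  by apply: nmin; exact/asboolP.
by right; split=> // n xn; apply: h; exists n.+1; apply/asboolP; exact: movable_ex.
Qed.

Definition target n x := crd_inv n (al n (pos x n)).+1.

(** The move is made at the least possible rank; [successor_up] shows, through [crd_diff], that any
    other movable rank describes the same move. Points that are regular at no rank are fixed. *)
Definition successor x : digits q :=
  if first_movable x is Some n then place n (target n x) x else x.

Definition moves_up (U : digits q -> digits q) := forall n x, movable n x ->
  same_tail n x (U x) /\ al n (pos (U x) n) = (al n (pos x n)).+1.

Lemma successor_up : moves_up successor.
Proof.
move=> n x xn; rewrite /successor.
have [[k [-> xk kmin]]|[_ /(_ n)]] := first_movableP x; last by case: xn.
have kn := kmin _ xn; have [tk etk] := crd_invP xk.2.
have tl : same_tail k x (place k (target k x) x) by move=> i ki; rewrite place_tail.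
split; first exact: same_tailW tl.
have := crd_diff xk.1 tl kn; rewrite (pos_place q_gt1 _ tk) etk; lia.
Qed.

Lemma successor_irregular x : (forall n, ~ regular n x) -> successor x = x.
Proof.
move=> xn; rewrite /successor; have [[k [_ [xk _] _]]|[-> _]//] := first_movableP x.
by have := xn k xk.
Qed.

Section iterates.
Variables U V : digits q -> digits q.
Hypotheses (U_up : moves_up U) (UK : cancel U V) (VK : cancel V U).

Lemma iter_up n x k : regular n x -> al n (pos x n) + k < radix q n ->
  same_tail n x (iter k U x) /\ al n (pos (iter k U x) n) = al n (pos x n) + k.
Proof.
move=> xn; elim: k => [|k IH] h; first by rewrite addn0.
have [|t e] := IH; first by lia.
have [|t' e'] := U_up (n := n) (x := iter k U x).
  by split; [exact: regular_tail t _|rewrite e; lia].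
by rewrite iterS; split; [exact: same_tail_trans t t'|rewrite e' e addnS].
Qed.

Lemma reach n x y : regular n x -> same_tail n x y -> al n (pos x n) <= al n (pos y n) ->
  y = iter (al n (pos y n) - al n (pos x n)) U x.
Proof.
move=> xn xy le; have [|t e] := iter_up (k := al n (pos y n) - al n (pos x n)) xn.
  by rewrite subnKC// crd_pos_lt.
apply: (@crd_pos_inj _ _ n); last by rewrite e subnKC.
exact: same_tail_trans (same_tail_sym xy) t.
Qed.

Lemma iterK k : cancel (iter k U) (iter k V).
Proof. by elim: k => // k IH x; rewrite iterSr iterS UK IH. Qed.

Lemma reachz n x y : regular n x -> same_tail n x y ->
  y = iter_int U V ((al n (pos y n))%:Z - (al n (pos x n))%:Z)%R x.
Proof.
move=> xn xy; have [le|lt] := leqP (al n (pos x n)) (al n (pos y n)).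
  by rewrite subzn//=; exact: reach.
have := reach (regular_tail xy xn) (same_tail_sym xy) (ltnW lt).
move: (al n (pos x n)) (al n (pos y n)) lt => a b ba /(congr1 (iter (a - b) V)).
rewrite iterK => <-; have -> : (b%:Z - a%:Z = - (a - b)%:Z)%R by lia.
have: 0 < a - b by lia.
by case: (a - b).
Qed.

(** The right-hand side, the class of [x] for equality of tails, does not mention the coordinate:
    hence [S] and [T] have the same orbits. *)
Lemma iter_int_orbit n x : regular n x ->
  range (fun k => iter_int U V k x) = [set y | exists m, n <= m /\ same_tail m x y].
Proof.
move=> xn; apply/seteqP; split=> [_ [k _ <-]|y [m [nm xy]]]; last first.
  have xm := regularW nm xn.
  by exists ((al m (pos y m))%:Z - (al m (pos x m))%:Z)%R => //; rewrite -(reachz xm xy).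
case: k => k /=.
  exists (n + k); split; first exact: leq_addr.
  have [_ h] := crd_grow k xn.
  by have [] := iter_up (regularW (leq_addr k n) xn) h.
(* At rank [n + k.+1] there are at least [k.+1] levels below [x]; the point [y] lies [k.+1] levels
   down. *)
pose l := n + k.+1; have [h _] := crd_grow k.+1 xn; have xl := regularW (leq_addr k.+1 n) xn.
have [h1 e1] := crd_invP (n := l) (k := al l (pos x l) - k.+1)
  (leq_ltn_trans (leq_subr _ _) (crd_pos_lt x l)).
pose y := place l (crd_inv l (al l (pos x l) - k.+1)) x.
have xy : same_tail l x y by move=> i li; rewrite /y place_tail.
have ey : al l (pos y l) = al l (pos x l) - k.+1 by rewrite pos_place.
exists l; split; first exact: leq_addr.
suff -> : V (iter k V x) = y by [].
have -> : x = iter k.+1 U y.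
  have := reach (regular_tail xy xl) (same_tail_sym xy).
  rewrite ey leq_subr => /(_ isT) {1}->; congr iter.
  have : k.+1 <= al l (pos x l) := h.
  lia.
by rewrite -iterS iterK.
Qed.

End iterates.

End coordinate.

(** A relation rather than the function [opposite], since reversing twice gives back [al] only on
    positions below [radix q n]. *)
Definition opposites al al' := forall n p, p < radix q n ->
  (al n p + al' n p).+1 = radix q n.

Lemma opposites_opposite al st : coordinate al st -> opposites al (opposite al).
Proof. by move=> alP n p /(crd_lt alP); rewrite /opposite; lia. Qed.

(** Going up and then up in the reversed coordinate restores the coordinate. After the first move,
    [x] itself provides the room for the second one at the same rank. *)
Lemma successorK al st al' st' : coordinate al st -> coordinate al' st' ->
  opposites al al' -> cancel (successor al) (successor al').
Proof.
move=> alP alP' op x.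
have [[n xn]|/forallNP xn] := pselect (exists n, regular n x); last first.
  by rewrite !(successor_irregular alP xn, successor_irregular alP' xn).
have xm := movable_ex alP xn; have [t e] := successor_up alP xm.
set y := successor al x in t e *.
have o1 := op n.+1 _ (pos_lt q_gt1 x n.+1); have o2 := op n.+1 _ (pos_lt q_gt1 y n.+1).
have ym : movable al' n.+1 y.
  by split; [exact: regular_tail t (regularW (leqnSn n) xn)|lia].
have [t' e'] := successor_up alP' ym.
have o3 := op n.+1 _ (pos_lt q_gt1 (successor al' y) n.+1).
apply/esym/(crd_pos_inj alP (n := n.+1)); first exact: same_tail_trans t t'.
lia.
Qed.

(** * Cocycles between the successor maps of two coordinates *)

Section cocycle.
Variables (al sa be sb : nat -> nat -> nat).
Hypotheses (alP : coordinate al sa) (beP : coordinate be sb).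

Definition displacement n p : int :=
  ((be n (crd_inv al n (al n p).+1))%:Z - (be n p)%:Z)%R.

(** With [al] the height and [be] the position, this is the cocycle of [T] over [S]; exchanging them
    gives that of [S] over [T]. *)
Definition cocycle x : int :=
  if first_movable al x is Some n then displacement n (pos x n) else 0%R.

Lemma cocycle_irregular x : (forall n, ~ regular n x) -> cocycle x = 0%R.
Proof.
move=> xn; rewrite /cocycle; have [[k [_ [xk _] _]]|[-> _]//] := first_movableP alP x.
by have := xn k xk.
Qed.

Lemma displacementE U n x : moves_up al U -> movable al n x ->
  displacement n (pos x n) = ((be n (pos (U x) n))%:Z - (be n (pos x n))%:Z)%R.
Proof.
move=> U_up xn; have [_ e] := U_up n x xn.
by rewrite /displacement -e (crd_invK alP)// pos_lt.
Qed.

Lemma cocycle_at n x : movable al n x -> cocycle x = displacement n (pos x n).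
Proof.
move=> xn; have U_up := successor_up alP; rewrite (displacementE U_up xn) /cocycle.
have [[k [-> xk kmin]]|[_ /(_ n)]] := first_movableP alP x; last by case: xn.
have [t _] := U_up k x xk; rewrite (displacementE U_up xk).
have := crd_diff beP xk.1 t (kmin _ xn); lia.
Qed.

Lemma cocycleE U n x : moves_up al U -> movable al n x ->
  cocycle x = ((be n (pos (U x) n))%:Z - (be n (pos x n))%:Z)%R.
Proof. by move=> U_up xn; rewrite (cocycle_at xn) (displacementE U_up). Qed.

Lemma cocycle_iter_int U V W n x : moves_up al U -> moves_up be V -> cancel V W ->
  regular n x -> U x = iter_int V W (cocycle x) x.
Proof.
move=> U_up V_up VK xn; have xm := movable_ex alP xn.
have [t _] := U_up _ _ xm.
rewrite (cocycleE U_up xm); exact: (reachz beP V_up VK xm.1 t).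
Qed.

(** Once a movable rank is fixed, the cocycle depends only on the position at that rank; the
    remaining points are never regular and have cocycle 0. *)
Lemma measurable_cocycle (k : int) :
  measurable (cocycle @^-1` [set k] : set (odometer_space q)).
Proof.
pose M n : set (odometer_space q) := regular n `&`
  [set x : digits q | [set p | (al n p).+1 < radix q n] (pos x n)].
have mM n : measurable (M n).
  by apply: measurableI; [exact: measurable_regular|exact: measurable_pos].
rewrite (_ : _ @^-1` _ = \bigcup_n (M n `&`
    [set x : digits q | [set p | displacement n p = k] (pos x n)])
   `|` (if k == 0%R then ~` \bigcup_n M n else set0)).
  apply: measurableU; last first.
    by case: ifP => // _; apply: measurableC; exact: bigcupT_measurable.
  by apply: bigcupT_measurable => n; apply: measurableI => //; exact: measurable_pos.
apply/seteqP; split=> x /=.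
  have [[n xn] xk|/forallNP xn] := pselect (exists n, regular n x).
    left; have xm := movable_ex alP xn; exists n.+1 => //; split=> //=.
    by rewrite -(cocycle_at xm).
  rewrite cocycle_irregular// => <-; right; rewrite eqxx => -[n _ [/= xr _]].
  exact: xn xr.
move=> [[n _ [xn /= <-]]|]; first exact: cocycle_at.
case: eqP => // -> xn; apply: cocycle_irregular => n xr; apply: xn.
by exists n.+1 => //; have [? ?] := movable_ex alP xr.
Qed.

End cocycle.

Lemma cocycle_opposite al sa al' sa' be sb x :
  coordinate al sa -> coordinate al' sa' -> coordinate be sb -> opposites al al' ->
  cocycle al' be (successor al x) = (- cocycle al be x)%R.
Proof.
move=> alP alP' beP op.
have [[n xn]|/forallNP xn] := pselect (exists n, regular n x); last first.
  rewrite (successor_irregular alP xn).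
  by rewrite (cocycle_irregular _ alP xn) (cocycle_irregular _ alP' xn) oppr0.
have xm := movable_ex alP xn; have [t e] := successor_up alP xm.
have ym : movable al' n.+1 (successor al x).
  split; first exact: regular_tail t (regularW (leqnSn n) xn).
  have := op n.+1 _ (pos_lt q_gt1 x n.+1).
  by have := op n.+1 _ (pos_lt q_gt1 (successor al x) n.+1); lia.
rewrite (cocycleE alP' beP (successor_up alP') ym) (cocycleE alP beP (successor_up alP) xm).
by rewrite (successorK alP alP' op); lia.
Qed.

End coordinates.

(** * Piecewise powers of an automorphism *)

Local Open Scope ring_scope.

Lemma measure_partition_nat (R : realType) d (X : measurableType d)
    (mu : {measure set X -> \bar R}) (f : X -> nat) B :
  (forall k, measurable (f @^-1` [set k])) -> measurable B ->
  mu B = (\sum_(0 <= k <oo) mu (f @^-1` [set k] `&` B))%E.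
Proof.
move=> mf mB; rewrite -measure_semi_bigcup.
- congr (mu _); apply/seteqP; split=> [x Bx|x [k _ []]//].
  by exists (f x).
- by move=> k; exact: measurableI.
- by move=> i j _ _ [x [[/= <- _] [/= <- _]]].
- by apply: bigcupT_measurable => k; exact: measurableI.
Qed.

Section iterates.
Context (R : realType) d (X : measurableType d) (mu : probability X R).
Variable S : automorphism mu.

Lemma iter_mpK k : cancel (iter k S) (iter k (mp_inv S)).
Proof. by elim: k => // k IH x; rewrite iterSr iterS mp_funK IH. Qed.

Lemma iter_mp_invK k : cancel (iter k (mp_inv S)) (iter k S).
Proof. by elim: k => // k IH x; rewrite iterSr iterS mp_invK IH. Qed.

Lemma iterzK k x : iterz S (- k) (iterz S k x) = x.
Proof.
by case: k => [[|k]|k] //; [exact: (iter_mpK k.+1)|exact: (iter_mp_invK k.+1)].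
Qed.


Lemma measurable_iter (f : X -> X) k : measurable_fun setT f -> measurable_fun setT (iter k f).
Proof.
move=> mf; elim: k => [|k IH]; first exact: measurable_id.
exact: (measurableT_comp mf IH).
Qed.

Lemma measurable_iterz k : measurable_fun setT (iterz S k).
Proof.
by case: k => k; apply: measurable_iter; [exact: measurable_mp_fun|exact: measurable_mp_inv].
Qed.

Lemma measurable_preimageT d' (Y : measurableType d') (f : X -> Y) A :
  measurable_fun setT f -> measurable A -> measurable (f @^-1` A).
Proof. by move=> mf mA; rewrite -[X in measurable X]setTI; exact: mf. Qed.

Lemma mp_preimage A : measurable A -> mu (S @^-1` A) = mu A.
Proof. exact: mp_pushforward. Qed.

Lemma mp_inv_preimage A : measurable A -> mu (mp_inv S @^-1` A) = mu A.
Proof.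
move=> mA; rewrite -mp_preimage; last exact: measurable_preimageT (measurable_mp_inv S) mA.
by congr (mu _); apply/seteqP; split=> x /=; rewrite mp_funK.
Qed.

Lemma iter_preimage (f : X -> X) k A : measurable_fun setT f ->
  (forall A, measurable A -> mu (f @^-1` A) = mu A) -> measurable A ->
  mu (iter k f @^-1` A) = mu A.
Proof.
move=> mf fmu; elim: k A => // k IH A mA.
by rewrite -(fmu A)// -(IH (f @^-1` A))//; exact: measurable_preimageT.
Qed.

Lemma iterz_preimage k A : measurable A -> mu (iterz S k @^-1` A) = mu A.
Proof.
case: k => k mA; apply: iter_preimage => //.
- exact: measurable_mp_fun.
- exact: mp_preimage.
- exact: measurable_mp_inv.
- exact: mp_inv_preimage.
Qed.

Lemma measurable_piecewise (T : X -> X) (c : X -> int) :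
  (forall k, measurable (c @^-1` [set k])) -> (forall x, T x = iterz S (c x) x) ->
  measurable_fun setT T.
Proof.
move=> mc TE _ A mA; rewrite setTI.
rewrite (_ : T @^-1` A = \bigcup_k (c @^-1` [set k] `&` iterz S k @^-1` A)).
  apply: countable_bigcupT_measurable => // k; apply: measurableI => //.
  exact: measurable_preimageT (measurable_iterz k) mA.
apply/seteqP; split=> [x /= TA|x [k _ [/= <-]]]; last by rewrite TE.
by exists (c x) => //; split=> //=; rewrite -TE.
Qed.

Variables (T U : X -> X) (c e : X -> int).
Hypotheses (TK : cancel T U) (UK : cancel U T).
Hypotheses (mc : forall k, measurable (c @^-1` [set k]))
  (me : forall k, measurable (e @^-1` [set k])).
Hypotheses (TE : forall x, T x = iterz S (c x) x) (UE : forall x, U x = iterz S (e x) x).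
Hypothesis ec : forall x, e (T x) = - c x.

Let mT : measurable_fun setT T. Proof. exact: measurable_piecewise mc TE. Qed.
Let mU : measurable_fun setT U. Proof. exact: measurable_piecewise me UE. Qed.

(* [T] is [S^k] on the piece [c = k], and carries it onto the piece [e = -k]. *)
Lemma piecewise_piece k A :
  c @^-1` [set k] `&` T @^-1` A = iterz S k @^-1` (e @^-1` [set - k] `&` A).
Proof.
apply/seteqP; split=> x /=.
  by move=> [<- TA]; rewrite -TE ec.
move=> [ek SA]; have Ux : U (iterz S k x) = x by rewrite UE ek iterzK.
have Tx : T x = iterz S k x by rewrite -[in LHS]Ux UK.
by rewrite Tx; split=> //; apply/eqP; rewrite -eqr_opp -ec Tx; apply/eqP.
Qed.

Lemma piecewise_preserves A : measurable A -> pushforward mu T A = mu A.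
Proof.
move=> mA; rewrite /pushforward.
have mTA : measurable (T @^-1` A) by exact: measurable_preimageT.
have mk (f : X -> int) : (forall k, measurable (f @^-1` [set k])) ->
    forall k, measurable ((fun x => pickle (f x)) @^-1` [set k]).
  move=> mf k; have [[j jk]|/forallNP nk] := pselect (exists j : int, pickle j = k).
    rewrite (_ : _ @^-1` _ = f @^-1` [set j])//.
    apply/seteqP; split=> x /= h; last by rewrite h.
    by apply: (pcan_inj pickleK); rewrite h.
  by rewrite (_ : _ @^-1` _ = set0)//; apply/seteqP; split=> // x /= /nk.
have mNe k : measurable ((fun x => - e x) @^-1` [set k]).
  rewrite (_ : _ @^-1` _ = e @^-1` [set - k])//.
  by apply/seteqP; split=> x /=; [move=> <-; rewrite opprK|move=> ->; rewrite opprK].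
rewrite (measure_partition_nat mu (mk _ mc) mTA) (measure_partition_nat mu (mk _ mNe) mA).
apply: eq_eseriesr => k _.
have [[j jk]|/forallNP nk] := pselect (exists j : int, pickle j = k).
  have pE (f : X -> int) : (fun x => pickle (f x)) @^-1` [set k] = f @^-1` [set j].
    apply/seteqP; split=> x /= h; last by rewrite h.
    by apply: (pcan_inj pickleK); rewrite h.
  rewrite !pE piecewise_piece.
  transitivity (mu (e @^-1` [set - j] `&` A)); first by apply/iterz_preimage/measurableI.
  congr (mu (_ `&` _)).
  by apply/seteqP; split=> x /=; [move=> ->; rewrite opprK|move=> <-; rewrite opprK].
have p0 (f : X -> int) : (fun x => pickle (f x)) @^-1` [set k] = set0.
  by apply/seteqP; split=> // x /= /nk.
by rewrite !p0 !set0I !measure0.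
Qed.

Definition piecewise_iso : automorphism mu :=
  MpIso TK UK mT mU piecewise_preserves.

End iterates.

(** * Return times of an irrational rotation *)

Local Open Scope ring_scope.

Section kronecker.
Variables (R : realType) (theta : R).
Hypothesis theta_irr : irrational theta.

Lemma irrational_neq (n : nat) (k : int) : (0 < n)%N -> n%:R * theta - k%:~R != 0.
Proof.
move=> n0; rewrite subr_eq0; apply/eqP => e; apply: theta_irr.
apply/rationalP; exists k, n; rewrite -e mulrC mulKf// pnatr_eq0; lia.
Qed.

(** Dirichlet's pigeonhole: [M.+1] fractional parts fall into [M] bins of width [1 / M < delta].
    Irrationality makes the resulting difference nonzero. *)
Lemma small_multiple (delta : R) : 0 < delta ->
  exists n (k : int), (0 < n)%N /\ 0 < `|n%:R * theta - k%:~R| < delta.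
Proof.
move=> d0; pose M := (Num.truncn delta^-1).+1.
have M0 : 0 < M%:R :> R by rewrite ltr0n.
have Md : M%:R^-1 < delta.
  by rewrite -[delta]invrK ltf_pV2 ?posrE ?invr_gt0// real_truncnS_gt// num_real.
pose fr (i : nat) : R := i%:R * theta - (Num.floor (i%:R * theta))%:~R.
have fr01 i : 0 <= fr i < 1.
  by have := floor_itv (i%:R * theta); rewrite intrD /fr; lra.
have binlt (i : 'I_M.+1) : (Num.truncn (fr i * M%:R) < M)%N.
  have /andP[f0 f1] := fr01 i.
  by rewrite truncn_lt_nat ?mulr_ge0 ?(ltW M0)// gtr_pMl.
pose bin (i : 'I_M.+1) := Ordinal (binlt i).
have /injectivePn[i [j ij /(congr1 val) /= eij]] : ~~ injectiveb bin.
  by apply/negP => /injectiveP/leq_card; rewrite !card_ord ltnn.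
wlog lij : i j ij eij / (i < j)%N.
  move=> HW; have [lij|lji] := ltnP i j; first exact: HW lij.
  apply: (HW j i) => //; first by rewrite eq_sym.
  by rewrite ltn_neqAle lji andbT -(inj_eq val_inj) eq_sym in ij *.
exists (j - i)%N, (Num.floor (j%:R * theta) - Num.floor (i%:R * theta)).
split; first by rewrite subn_gt0.
rewrite normr_gt0 irrational_neq ?subn_gt0//=.
have -> : (j - i)%:R * theta - (Num.floor (j%:R * theta) -
    Num.floor (i%:R * theta))%:~R = fr j - fr i.
  by rewrite natrB ?(ltnW lij)// intrB /fr; lra.
apply: lt_trans Md; rewrite -[M%:R^-1]div1r ltr_pdivlMr// -[M%:R](gtr0_norm M0) -normrM mulrBl.
have /andP[fi _] := fr01 i; have /andP[fj _] := fr01 j.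
have := truncn_itv (mulr_ge0 fi (ltW M0)); have := truncn_itv (mulr_ge0 fj (ltW M0)).
by rewrite eij ltr_norml -!natr1; lra.
Qed.

Lemma dense_multiples (delta : R) : 0 < delta ->
  exists C : nat, forall y : R, exists (c : nat) (k : int),
    (c < C)%N /\ `|y + c%:R * theta - k%:~R| < delta.
Proof.
move=> d0; have [n [k [n0 /andP[e0 ed]]]] := small_multiple d0.
set e := n%:R * theta - k%:~R in e0 ed.
(* Steps of length [|e|] reach the neighbourhood of an integer after at most [1 / |e|] of them, from
   any [y], and each step uses [n] multiples of [theta]. The walk goes up or down according to the
   sign of [e]. *)
exists (n * (Num.truncn `|e|^-1).+1).+1 => y.
suff [s [z [se ze]]] : exists (s : nat) (z : int),
    s%:R * `|e| <= 1 /\ `|y + s%:R * e - z%:~R| < delta.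
  exists (n * s)%N, (z + k * s); split.
    rewrite ltnS leq_mul2l ltnW ?orbT//.
    rewrite -(ltr_nat R); apply: le_lt_trans (real_truncnS_gt _); last exact: num_real.
    by rewrite -[leRHS]mul1r ler_pdivlMr.
  rewrite (_ : _ - _ = y + s%:R * e - z%:~R)//.
  by rewrite /e natrM intrD intrM; lra.
have e1 := ltW e0.
have [ep|en] := ltP 0 e.
  pose w := (Num.floor y + 1)%:~R - y; have w01 : 0 <= w <= 1.
    by have := floor_itv y; rewrite /w intrD; lra.
  have w0 : 0 <= w / e by rewrite divr_ge0 ?(ltW ep)//; lra.
  exists (Num.truncn (w / e)), (Num.floor y + 1).
  have := truncn_itv w0; rewrite ler_pdivlMr// ltr_pdivrMr// => /andP[h1 h2].
  rewrite gtr0_norm// in ed e0 e1 *; split; first lra.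
  have wE : w = (Num.floor y + 1)%:~R - y by [].
  by move: h2; rewrite -natr1 mulrDl mul1r => h2; rewrite ltr_norml; lra.
have {}en : 0 < - e by rewrite oppr_gt0 lt_neqAle en andbT -normr_gt0.
pose w := y - (Num.floor y)%:~R; have w01 : 0 <= w <= 1.
  by have := floor_itv y; rewrite /w intrD; lra.
have w0 : 0 <= w / - e by rewrite divr_ge0 ?(ltW en)//; lra.
exists (Num.truncn (w / - e)), (Num.floor y).
have := truncn_itv w0; rewrite ler_pdivlMr// ltr_pdivrMr// => /andP[h1 h2].
rewrite -normrN gtr0_norm// in ed e0 e1 *; split; first lra.
have wE : w = y - (Num.floor y)%:~R by [].
by move: h2; rewrite -natr1 mulrDl mul1r => h2; rewrite ltr_norml; lra.
Qed.

Lemma return_times (delta : R) : 0 < delta ->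
  exists C : nat, (1 < C)%N /\ forall y : R, exists (c : nat) (k : int),
    (0 < c < C)%N /\ `|y + c%:R * theta - k%:~R| < delta.
Proof.
move=> d0; have [C CP] := dense_multiples d0.
exists C.+1; split.
  by have [c [_ [cC _]]] := CP 0; lia.
(* Starting from [y + theta] spends one multiple in advance, which makes the return time
   positive. *)
move=> y; have [c [k [cC h]]] := CP (y + theta); exists c.+1, k; split; first lia.
by move: h; rewrite -natr1 mulrDl mul1r [c%:R * _ + _]addrC addrA.
Qed.

End kronecker.

(** * Spacers *)

Local Open Scope nat_scope.

Lemma count_div a D (Q : pred nat) :
  \sum_(j < a * D | Q (j %/ D)) 1 = (\sum_(i < a | Q i) 1) * D.
Proof.
have [->|D0] := posnP D; first by rewrite !muln0 big_ord0.
rewrite -(big_mkord (fun j => Q (j %/ D)) (fun=> 1)).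
elim: a => [|a IH]; first by rewrite mul0n big_geq// big_ord0.
rewrite (@big_cat_nat _ _ _ (a * D)) ?leq_mul//= IH mulSnr.
rewrite -{1}[a * D]add0n [_ + D]addnC big_addn addnK big_mkord.
rewrite [in RHS]big_mkcond big_ord_recr /= -big_mkcond mulnDl; congr addn.
rewrite (eq_bigl (fun=> Q a)) => [|j].
  by case: (Q a); [rewrite sum1_card card_ord mul1n|rewrite big_pred0].
by rewrite addnC divnMDl// divn_small ?addn0.
Qed.

(** The blocks of length [B] containing [k] and [k.+1] are equal or adjacent. Here [k] will be the
    coordinate that moves by one, [b] and [a] the other coordinate before and after the move. *)
Lemma div_close a b k B : a %/ B = k.+1 %/ B -> b %/ B = k %/ B -> 0 < B ->
  absz (a%:Z - b%:Z)%R <= 2 * B.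
Proof.
move=> ea eb B0.
have := ltn_pmod a B0; have := ltn_pmod b B0; have := ltn_pmod k B0; have := ltn_pmod k.+1 B0.
have := divn_eq a B; have := divn_eq b B; have := divn_eq k B; have := divn_eq k.+1 B.
rewrite ea eb; have : k %/ B <= k.+1 %/ B by exact: leq_div2r.
have : k.+1 %/ B <= (k %/ B).+1.
  rewrite -ltnS ltn_divLR// !mulSn.
  by have := divn_eq k B; have := ltn_pmod k B0; lia.
move: (k %/ B) (k.+1 %/ B) => u v uv vu; have [->|->] : v = u \/ v = u.+1 by lia.
  by lia.
by rewrite mulSn; lia.
Qed.

Section stage.
Variables (C m : nat -> nat) (o : nat -> nat -> nat).
Hypothesis m_gt0 : forall n, 0 < m n.
Hypothesis C_gt1 : forall n, 1 < C n.
Hypothesis o_range : forall n j, 0 < o n j < C n.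

Local Notation H := (stage_height C m).
Local Notation L := (stage_block C m).
Local Notation N := (stage_radix C m).
Local Notation good := (column_digit C m).
Local Notation tau := (tower_rank C m o).

Let N1 : forall n, 1 < N n. Proof. exact: stage_radix_gt1. Qed.

Lemma pos_coordinate : coordinate N good (fun n p => p) (fun n d => d * radix N n).
Proof.
split=> // [n p _ _|n d _ /column_digit_gt0 d0|n d dN gd].
- by rewrite -divn_eq.
- by rewrite muln_gt0 d0 radix_gt0.
- by rewrite -mulSnr radixS mulnC ltn_pmul2l ?radix_gt0// column_digit_lt.
Qed.

Lemma tower_rank_coordinate : coordinate N good tau (column_start C m o).
Proof.
split=> [n p|n p p'|n p _|n d _ _|n d]; rewrite ?radix_stage.
- exact: tower_rank_lt.
- exact: tower_rank_inj.
- exact: tower_rank_step.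
- exact: column_start_gt0.
- exact: column_start_lt.
Qed.

Lemma odometer_up : moves_up good (fun n p => p) (@odometer N).
Proof.
move=> n x [_ xn]; rewrite pos_odometer// modn_small//; split=> // i ni.
rewrite /odometer; case: forallP => // h.
suff : [forall i : 'I_n, (x i).+1 == N i] by rewrite pos_max// => /eqP; lia.
apply/forallP => j; exact: (h (Ordinal (leq_trans (ltn_ord j) ni))).
Qed.

Lemma count_spacers n : \sum_(v < L n | ~~ (0 < v <= H n)) 1 = C n.
Proof.
have h0 := stage_height_gt0 C m_gt0 n; have c1 := C_gt1 n.
have LE : L n = H n + C n by [].
rewrite -(big_mkord (fun v => ~~ (0 < v <= H n)) (fun=> 1)).
rewrite (@big_cat_nat _ _ _ 1) ?LE//=; last by lia.
rewrite (@big_cat_nat _ _ _ (H n).+1 1)//=; last by lia.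
rewrite big_mkcond big_nat1 /= [X in _ + (X + _)]big_nat_cond big_pred0 => [|v]; last by lia.
rewrite big_nat_cond (eq_bigl (fun v => (H n < v < H n + C n) && true)) => [|v]; last by lia.
by rewrite -(big_nat_cond _ _ (H n).+1 (H n + C n) xpredT) sum_nat_const_nat; lia.
Qed.

Section measure.
Local Open Scope ring_scope.
Context (R : realType) (mu : probability (odometer_space N) R).
Hypothesis muN : is_uniform_product mu.

Definition spacer_set n : set (odometer_space N) := [set x : digits N | ~~ good n (x n)].

Lemma measurable_spacer_set n : measurable (spacer_set n).
Proof.
rewrite (_ : spacer_set n = [set x : digits N |
    [set p | ~~ good n (p %/ radix N n)%N] (pos x n.+1)]); first exact: measurable_pos.
by apply/seteqP; split=> x /=; rewrite pos_div.
Qed.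

Lemma spacer_set_measure n : mu (spacer_set n) = ((C n)%:R / (L n)%:R)%:E.
Proof.
rewrite (_ : spacer_set n = [set x : digits N |
    [pred p | ~~ good n (p %/ radix N n)%N] (pos x n.+1)]); last first.
  by apply/seteqP; split=> x /=; rewrite pos_div.
rewrite (uniform_pos_set N1 muN).
have h0 := stage_height_gt0 C m_gt0 n; have m0 := m_gt0 n; have l0 := stage_block_gt0 C m_gt0 n.
have -> : (\sum_(k < radix N n.+1 | [pred p | ~~ good n (p %/ radix N n)%N] k) 1)%N =
   (m n * C n * H n)%N.
  rewrite radixS mulnC (count_div _ _ (fun d => ~~ good n d)) radix_stage.
  rewrite (count_mod _ _ (fun v => ~~ (0 < v <= H n)%N)); congr (_ * _ * _)%N.
  exact: count_spacers.
rewrite radixS radix_stage -[N n]/(m n * L n)%N !natrM; congr _%:E.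
have h0' : (H n)%:R != 0 :> R by rewrite pnatr_eq0; lia.
have m0' : (m n)%:R != 0 :> R by rewrite pnatr_eq0; lia.
have l0' : (L n)%:R != 0 :> R by rewrite pnatr_eq0; lia.
by field; rewrite h0' m0' l0'.
Qed.

End measure.
End stage.

(** * Integrability of the cocycles *)

Local Open Scope ring_scope.

Lemma nneseries_geometric_lty (R : realType) (A : R) (u : nat -> R) :
  (forall n, 0 <= u n <= A * 2^-1 ^+ n) -> (\sum_(n <oo) (u n)%:E < +oo)%E.
Proof.
move=> uA; apply: (@le_lt_trans _ _ (\sum_(n <oo) (2 * A / (2 ^ (n + 1))%:R)%:E)%E).
  apply: lee_nneseries => [n _ _|n _]; rewrite lee_fin.
    by case/andP: (uA n).
  case/andP: (uA n) => _ h; apply: le_trans h _.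
  by rewrite expnD expn1 natrM natrX exprVn invfM; lra.
have /cvg_lim -> // := @cvg_geometric_eseries_half R (2 * A) 0.
exact: ltry.
Qed.

Lemma measurable_fun_discrete d d' (X : measurableType d) (Y : measurableType d')
    (c : X -> int) (f : int -> Y) :
  (forall k, measurable (c @^-1` [set k])) -> measurable_fun setT (f \o c).
Proof.
move=> mc _ B mB; rewrite setTI.
rewrite (_ : _ @^-1` B = \bigcup_k (if `[< B (f k) >] then c @^-1` [set k] else set0)).
  by apply: countable_bigcupT_measurable => // k; case: ifP.
apply/seteqP; split=> [x /= Bx|x [k _]].
  by exists (c x) => //; rewrite asboolT.
by case: asboolP => // Bk /= cx; rewrite cx.
Qed.

Section stage.
Variables (C m : nat -> nat).
Hypothesis m_gt0 : forall n, (0 < m n)%N.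
Hypothesis C_gt1 : forall n, (1 < C n)%N.

Local Notation H := (stage_height C m).
Local Notation L := (stage_block C m).
Local Notation N := (stage_radix C m).
Local Notation good := (column_digit C m).
Hypothesis height_big : forall n, ((2 ^ n.+1 * (C n.+1).+1) ^ 3 <= H n.+1)%N.

Let N1 : forall n, (1 < N n)%N. Proof. exact: stage_radix_gt1. Qed.

Lemma leq_expn3 a : (a <= a ^ 3)%N.
Proof. by rewrite !expnS expn0 muln1; nia. Qed.

Lemma spacer_ratio (R : realType) n : (C n)%:R / (L n)%:R <= 2^-1 ^+ n :> R.
Proof.
have l0 : 0 < (L n)%:R :> R by rewrite ltr0n stage_block_gt0.
have p0 : 0 < 2 ^+ n :> R by rewrite exprn_gt0.
rewrite exprVn ler_pdivrMr// ler_pdivlMl// -natrX -natrM ler_nat.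
have LE : L n = (H n + C n)%N by [].
case: n {l0 p0} LE => [|n] LE; first by rewrite expn0; lia.
by have := height_big n; have := leq_expn3 (2 ^ n.+1 * (C n.+1).+1); rewrite mulnS; lia.
Qed.

Context (R : realType) (mu : probability (odometer_space N) R).
Hypothesis muN : is_uniform_product mu.

(** Borel-Cantelli: the spacer sets have measures [C n / L n], at most [2^-n]. *)
Lemma ae_regular : {ae mu, forall x, exists n, regular good n x}.
Proof.
exists (lim_sup_set (@spacer_set C m)); split.
- apply: bigcap_measurable => [|n _]; first by exists 0%N.
  by apply: bigcup_measurable => k _; exact: measurable_spacer_set.
- apply: lim_sup_set_cvg0 => [k|]; first exact: measurable_spacer_set.
  rewrite (@eq_eseriesr _ _ (fun n => ((C n)%:R / (L n)%:R)%:E)) => [|n _]; last first.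
    exact: (spacer_set_measure m_gt0 C_gt1 muN).
  apply: (@nneseries_geometric_lty _ 1) => n.
  by rewrite mul1r spacer_ratio divr_ge0.
move=> x /= /forallNP xn n _; apply: contrapT => h; apply: (xn n) => i ni.
by apply: contrapT => /negP gi; apply: h; exists i.
Qed.

(** A nondecreasing majorant of [phi] on the naturals: it lets a bound on the displacement bound the
    integrand, while [phi] may fail to be monotone. *)
Definition weight (D : R) (K : nat) := D + D * (K%:R `^ 3^-1).

Lemma weight_ge0 D K : 0 <= D -> 0 <= weight D K.
Proof. by move=> D0; rewrite addr_ge0// mulr_ge0// powR_ge0. Qed.

Lemma le_weight D K K' : 0 <= D -> (K <= K')%N -> weight D K <= weight D K'.
Proof.
move=> D0 KK; rewrite lerD2l ler_wpM2l// ge0_ler_powR ?nnegrE ?ler_nat//.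
Qed.

(* [(4 H^2)^(1/3) H^(1/3) = (4 H^3)^(1/3) <= 2 H] *)
Lemma powR_third_bound (h K a : R) : 0 < a -> a ^+ 3 <= h -> K <= 4 * h ^+ 2 -> 0 <= K ->
  K `^ 3^-1 * a <= 2 * h.
Proof.
move=> a0 ah Kh K0; have h0 : 0 < h by apply: lt_le_trans ah; rewrite exprn_gt0.
have third (x : R) : 0 <= x -> (x ^+ 3) `^ 3^-1 = x.
  by move=> x0; rewrite -powR_mulrn// -powRrM mulfV ?powRr1// pnatr_eq0.
rewrite -[X in _ * X](third a (ltW a0)) -powRM ?exprn_ge0 ?(ltW a0)//.
rewrite -[leRHS](third (2 * h)); last by rewrite mulr_ge0 ?(ltW h0).
rewrite ge0_ler_powR ?nnegrE ?invr_ge0 ?mulr_ge0 ?exprn_ge0 ?mulr_ge0 ?(ltW h0) ?(ltW a0)//.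
apply: (@le_trans _ _ (4 * h ^+ 2 * h)).
  by rewrite ler_pM// exprn_ge0// ltW.
have : 0 <= h ^+ 3 by rewrite exprn_ge0 ?ltW.
by rewrite exprMn; lra.
Qed.

Lemma stage_cost (D : R) : 0 <= D ->
  exists A, forall n, weight D (2 * (L n * H n)) * ((C n)%:R / (L n)%:R + (H n)%:R^-1)
     <= A * 2^-1 ^+ n.
Proof.
(* The first term settles [n = 0], where [C 0 / L 0] and [1 / H 0] are at most 1. For the other
   ranks, [D * h + D * K^(1/3) * h <= 3 * D * H] with [h] as below, so [5 * D] is ample. *)
move=> D0; exists (weight D (2 * (L 0 * H 0)) * 2 + 5 * D) => -[|n].
  rewrite expr0 mulr1 -[leLHS]addr0 lerD ?mulr_ge0//.
  rewrite ler_wpM2l ?weight_ge0//.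
  have := spacer_ratio R 0; rewrite expr0; have -> : H 0 = 1%N by []; rewrite invr1; lra.
set h := (2 ^ n.+1 * (C n.+1).+1)%N; have hH : (h ^ 3 <= H n.+1)%N := height_big n.
have h3 := leq_trans (leq_expn3 h) hH.
have ch : (C n.+1 < h)%N by rewrite /h leq_pmull// expn_gt0.
set K := (2 * (L n.+1 * H n.+1))%N.
have LE : L n.+1 = (H n.+1 + C n.+1)%N by [].
have K4 : (K <= 4 * H n.+1 ^ 2)%N by rewrite /K LE; nia.
have h0 : 0 < (H n.+1)%:R :> R by rewrite ltr0n stage_height_gt0.
have p0 : 0 < 2 ^+ n.+1 :> R by rewrite exprn_gt0.
have cube : K%:R `^ 3^-1 * h%:R <= 2 * (H n.+1)%:R :> R.
  apply: powR_third_bound => //; first by rewrite ltr0n; lia.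
    by rewrite -natrX ler_nat.
  by rewrite -natrX -natrM ler_nat.
have ratio : (C n.+1)%:R / (L n.+1)%:R + (H n.+1)%:R^-1
    <= h%:R / (2 ^+ n.+1 * (H n.+1)%:R) :> R.
  rewrite /h natrM natrX -mulf_div mulfV ?gt_eqF// mul1r -natr1 mulrDl mul1r lerD2r.
  rewrite ler_wpM2l// lef_pV2 ?posrE ?ltr0n ?stage_block_gt0 ?stage_height_gt0//.
  by rewrite ler_nat LE leq_addr.
apply: le_trans (ler_wpM2l (weight_ge0 _ D0) ratio) _.
have w0 := weight_ge0 (2 * (L 0 * H 0)) D0.
have hh : h%:R <= (H n.+1)%:R :> R by rewrite ler_nat.
suff main : weight D K * h%:R <= (weight D (2 * (L 0 * H 0)) * 2 + 5 * D) * (H n.+1)%:R.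
  rewrite exprVn invfM [_^-1 * _^-1]mulrC !mulrA ler_wpM2r ?invr_ge0 ?(ltW p0)//.
  by rewrite ler_pdivrMr.
rewrite {1}/weight mulrDl -mulrA.
have := ler_wpM2l D0 cube; have := ler_wpM2l D0 hh.
have : 0 <= weight D (2 * (L 0 * H 0)) * (H n.+1)%:R by rewrite mulr_ge0.
have : 0 <= D * (H n.+1)%:R by rewrite mulr_ge0.
lra.
Qed.

(** * The integral of [phi] along a cocycle, for either order of the two coordinates *)

Section cocycle_integral.
Variables (al sa be sb : nat -> nat -> nat).
Hypotheses (alP : coordinate N good al sa) (beP : coordinate N good be sb).
Hypothesis al_block : forall n p, (p < radix N n.+1)%N ->
  (al n.+1 p %/ (L n * H n) = p %/ (L n * H n))%N.
Hypothesis be_block : forall n p, (p < radix N n.+1)%N ->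
  (be n.+1 p %/ (L n * H n) = p %/ (L n * H n))%N.

Definition top_set n : set (odometer_space N) :=
  [set x : digits N | (al n (pos x n)).+1 = radix N n].

Lemma measurable_top_set n : measurable (top_set n).
Proof. exact: (@measurable_pos _ n [set p | (al n p).+1 = radix N n]). Qed.

Lemma top_set_measure n : mu (top_set n) = ((H n)%:R^-1)%:E.
Proof.
have r0 := radix_gt0 N1 n.
have lt : ((radix N n).-1 < radix N n)%N by rewrite prednK.
have [iv ie] := crd_invP alP lt.
rewrite -(radix_stage C m) -(uniform_pos N1 muN iv); congr (mu _).
rewrite /top_set; apply/seteqP; split=> x /= => [e|->]; last by rewrite ie prednK.
by apply: (crd_inj alP (pos_lt N1 x n) iv); rewrite ie -e.
Qed.

Lemma cocycle_bound n (x : digits N) : first_movable good al x = Some n.+1 ->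
  (absz (cocycle good al be x) <= 2 * (L n * H n))%N.
Proof.
have [[k [-> xm _]] [kn]|[-> _]//] := first_movableP N1 alP x; rewrite kn {k kn} in xm *.
have [_ e] := successor_up N1 alP xm.
rewrite (cocycleE N1 alP beP (successor_up N1 alP) xm).
apply: (@div_close _ _ (al n.+1 (pos x n.+1))); rewrite ?muln_gt0 ?stage_block_gt0 ?stage_height_gt0//.
  by rewrite be_block ?pos_lt// -al_block ?pos_lt// e.
by rewrite be_block ?pos_lt// -al_block ?pos_lt.
Qed.

(** If the digit of rank [n] is a copy, then [x] is already regular from rank [n] on; since it
    cannot move at that rank, it lies on the top level of the tower. *)
Lemma cocycle_cut n (x : digits N) : first_movable good al x = Some n.+1 ->
  (spacer_set n `|` top_set n) x.
Proof.
have [[k [-> [xr _] kmin]] [kn]|[-> _]//] := first_movableP N1 alP x.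
rewrite kn {k kn} in xr kmin.
have [gx|] := boolP (good n (x n)); [right|by left].
have xn : regular good n x.
  by move=> i; rewrite leq_eqVlt => /orP[/eqP <-//|]; exact: xr.
have lt := crd_pos_lt N1 alP x n.
apply/eqP; rewrite eqn_leq lt leqNgt; apply/negP => h.
by have := kmin n (conj xn h); rewrite ltnn.
Qed.

Lemma first_movable_neq0 (x : digits N) : first_movable good al x <> Some 0%N.
Proof.
have [[k [-> [_ h] _]] [k0]|[-> _]//] := first_movableP N1 alP x.
by move: h; rewrite k0 radix0.
Qed.

Variables (phi : R -> R) (D : R).
Hypothesis phi_ge0 : forall t, 0 <= t -> 0 <= phi t.
Hypothesis phi_le : forall k : nat, phi k%:R <= weight D k.
Hypothesis D0 : 0 <= D.

Lemma cocycle_integral :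
  (\int[mu]_x (phi (absz (cocycle good al be x))%:R)%:E < +oo)%E.
Proof.
pose w n := weight D (2 * (L n * H n)); have w0 n : 0 <= w n by exact: weight_ge0.
pose F n : set (odometer_space N) := spacer_set n `|` top_set n.
have mF n : measurable (F n).
  by apply: measurableU; [exact: measurable_spacer_set|exact: measurable_top_set].
pose f n (x : odometer_space N) : \bar R := (w n * \1_(F n) x)%:E.
have f0 n x : (0 <= f n x)%E by rewrite lee_fin mulr_ge0.
have mf n : measurable_fun setT (f n).
  by apply/measurable_EFinP; apply: measurable_funM => //; exact: measurable_indic.
have sf0 x : (0 <= \sum_(n <oo) f n x)%E by apply: nneseries_ge0.
have msf : measurable_fun setT (fun x => \sum_(n <oo) f n x)%E.
  by apply: ge0_emeasurable_sum.
have phi00 : 0 <= phi 0 by exact: phi_ge0.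
have mc : measurable_fun setT (fun x : odometer_space N =>
    (phi (absz (cocycle good al be x))%:R)%:E).
  exact: (measurable_fun_discrete (fun k => (phi (absz k)%:R)%:E)
    (measurable_cocycle N1 alP beP)).
(* The constant [phi 0] covers the points that never move; a point moving first at rank [n.+1] lies
   in [F n], where [w n] bounds the integrand. *)
apply: (@le_lt_trans _ _ (\int[mu]_x ((phi 0)%:E + \sum_(n <oo) f n x))%E).
  apply: ge0_le_integral => //.
  - by move=> x _; rewrite lee_fin phi_ge0.
  - exact: emeasurable_funD.
  move=> x _; case lx : (first_movable good al x) => [[|n]|].
    by have := first_movable_neq0 lx.
    apply: (@le_trans _ _ (w n)%:E).
      rewrite lee_fin; apply: le_trans (phi_le _) _.
      by apply: le_weight => //; exact: cocycle_bound.
    rewrite -[leLHS]add0e; apply: leeD; first by rewrite lee_fin.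
    have -> : (w n)%:E = f n x.
      by rewrite /f indicE mem_set ?mulr1//; exact: cocycle_cut.
    apply: (@le_trans _ _ (\sum_(0 <= k < n.+1) f k x)%E).
      by rewrite big_nat_recr//= leeDr// sume_ge0.
    exact: nneseries_lim_ge.
  rewrite /cocycle lx /= -[leLHS]adde0; exact: leeD.
rewrite ge0_integralD//.
rewrite integral_cst//= uniform_setT// mule1 lte_add_pinfty ?ltry//.
rewrite integral_nneseries//.
have [A AP] := stage_cost D0.
pose u n := w n * ((C n)%:R / (L n)%:R + (H n)%:R^-1).
apply: (@le_lt_trans _ _ (\sum_(n <oo) (u n)%:E)%E).
  apply: lee_nneseries => [n _ _|n _]; first exact: integral_ge0.
  rewrite /f; under eq_integral do rewrite EFinM.
  rewrite ge0_integralZl//; [|by apply/measurable_EFinP; exact: measurable_indic|by rewrite lee_fin].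
  rewrite integral_indic// setIT EFinM lee_wpmul2l//; first by rewrite lee_fin.
  apply: le_trans (measureU2 _ _ _) _ => //.
  - exact: measurable_spacer_set.
  - exact: measurable_top_set.
  rewrite le_eqVlt; apply/orP; left; apply/eqP; rewrite EFinD; congr (_ + _)%E.
    exact: (spacer_set_measure m_gt0 C_gt1 muN).
  exact: top_set_measure.
apply: (nneseries_geometric_lty (A := A)) => n.
by rewrite AP andbT mulr_ge0// addr_ge0 ?divr_ge0// invr_ge0.
Qed.

End cocycle_integral.

End stage.

(** * The rank-one system *)

Local Open Scope nat_scope.

Lemma iterz_iter_int (R : realType) d (X : measurableType d) (mu : probability X R)
  (S : automorphism mu) k x : iterz S k x = iter_int S (mp_inv S) k x.
Proof. by case: k. Qed.

(** This holds at every point, as [piecewise_iso] requires: where no rank is regular, the cocycle is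
    0 and the successor is the identity. *)
Lemma successor_iter_int q good (q_gt1 : forall n, 1 < q n) al st be sb U V (x : digits q) :
  coordinate q good al st -> coordinate q good be sb ->
  moves_up good be U -> cancel U V ->
  successor good al x = iter_int U V (cocycle good al be x) x.
Proof.
move=> alP beP U_up UK.
have [[n xn]|/forallNP xn] := pselect (exists n, regular good n x).
  exact: (cocycle_iter_int q_gt1 alP beP (successor_up q_gt1 alP) U_up UK xn).
by rewrite (successor_irregular q_gt1 alP xn) (cocycle_irregular q_gt1 be alP xn).
Qed.

Section stage.
Variables (C m : nat -> nat) (o : nat -> nat -> nat).
Hypothesis m_gt1 : forall n, 1 < m n.
Hypothesis C_gt1 : forall n, 1 < C n.
Hypothesis o_range : forall n j, 0 < o n j < C n.

Local Notation H := (stage_height C m).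
Local Notation L := (stage_block C m).
Local Notation N := (stage_radix C m).
Local Notation good := (column_digit C m).
Local Notation tau := (tower_rank C m o).

Let m_gt0 n : 0 < m n. Proof. exact: ltnW. Qed.
Let N1 : forall n, 1 < N n. Proof. exact: stage_radix_gt1. Qed.
Let tauP := tower_rank_coordinate m_gt0 C_gt1 o_range.
Let posP := pos_coordinate m_gt0 C_gt1.
Let tau'P := opposite_coordinate N1 tauP.
Let opP := opposites_opposite tauP.

Let opP' : opposites N (opposite N tau) tau.
Proof. by move=> n p pn; rewrite addnC; exact: opP. Qed.

Context (R : realType) (mu : probability (odometer_space N) R).
Hypothesis muN : is_uniform_product mu.

Let S := odometer_iso N1 muN.

Let T_iter_int x : successor good tau x = iterz S (cocycle good tau (fun=> id) x) x.
Proof.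
rewrite iterz_iter_int.
exact: (successor_iter_int N1 x tauP posP (odometer_up m_gt0 C_gt1) (mp_funK S)).
Qed.

Let U_iter_int x : successor good (opposite N tau) x =
  iterz S (cocycle good (opposite N tau) (fun=> id) x) x.
Proof.
rewrite iterz_iter_int.
exact: (successor_iter_int N1 x tau'P posP (odometer_up m_gt0 C_gt1) (mp_funK S)).
Qed.

(** Measurability and invariance of the measure come from writing [T] and its inverse as piecewise
    powers of the odometer; the inverse is the successor for the reversed height. *)
Definition tower_iso : automorphism mu :=
  piecewise_iso (S := S) (successorK N1 tauP tau'P opP) (successorK N1 tau'P tauP opP')
   (measurable_cocycle N1 tauP posP) (measurable_cocycle N1 tau'P posP)
   T_iter_int U_iter_int (fun x => cocycle_opposite N1 x tauP tau'P posP opP).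

Local Notation T := tower_iso.

Lemma tower_up : moves_up good tau T.
Proof. exact: (successor_up N1 tauP). Qed.

Lemma tower_iter_int x : T x = iterz S (cocycle good tau (fun=> id) x) x.
Proof. exact: T_iter_int. Qed.

Lemma odometer_iter_int n x : regular good n x ->
  S x = iterz T (cocycle good (fun=> id) tau x) x.
Proof.
move=> xn; rewrite iterz_iter_int.
exact: (cocycle_iter_int N1 posP tauP (odometer_up m_gt0 C_gt1) tower_up (mp_funK T) xn).
Qed.

Lemma tower_orbit n x : regular good n x -> orbit T x = orbit S x.
Proof.
move=> xn; rewrite /orbit.
rewrite (_ : (fun k => iterz T k x) = fun k => iter_int T (mp_inv T) k x); last first.
  by apply/funext => k; rewrite iterz_iter_int.
rewrite (_ : (fun k => iterz S k x) = fun k => iter_int S (mp_inv S) k x); last first.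
  by apply/funext => k; rewrite iterz_iter_int.
rewrite (iter_int_orbit N1 tauP tower_up (mp_funK T) xn).
by rewrite (iter_int_orbit N1 posP (odometer_up m_gt0 C_gt1) (mp_funK S) xn).
Qed.

Lemma tower_iter_neq n x k : regular good n x -> 0 < k -> iter k T x <> x.
Proof.
move=> xn k0 e; have [_ h] := crd_grow N1 tauP k xn.
have [_] := iter_up tower_up (regularW (leq_addr k n) xn) h.
by rewrite e; lia.
Qed.

(** Regularity is built in: a point with a later spacer digit enters the towers only after that
    rank. This makes the equalities between levels exact. *)
Definition tower_level n k : set (odometer_space N) :=
  [set x : digits N | regular good n x /\ tau n (pos x n) = k].

Lemma measurable_tower_level n k : measurable (tower_level n k).
Proof.
apply: measurableI; first exact: measurable_regular.
exact: (@measurable_pos _ n [set p | tau n p = k]).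
Qed.

Lemma iter_tower_level n k j : k + j < H n -> iter j T @` tower_level n k = tower_level n (k + j).
Proof.
rewrite -(radix_stage C m) => kj; apply/seteqP; split=> [_ [x [xn xk] <-]|y [yn ye]].
  have [|t e] := iter_up tower_up (n := n) (x := x) (k := j) xn; first by rewrite xk.
  by split; [exact: regular_tail t xn|rewrite e xk].
have kn : k < radix N n by apply: leq_ltn_trans kj; rewrite leq_addr.
have [pn pe] := crd_invP tauP kn.
pose x : digits N := place n (crd_inv N tau n k) y.
have yx : same_tail n y x by move=> i ni; rewrite /x place_tail.
have xe : tau n (pos x n) = k by rewrite /x pos_place.
have xn := regular_tail yx yn; exists x => //.
have := reach N1 tauP tower_up xn (same_tail_sym yx).
by rewrite xe ye leq_addr addKn => /(_ isT) <-.
Qed.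

Lemma image_tower_level n k : k.+1 < H n -> T @` tower_level n k = tower_level n k.+1.
Proof. by move=> kH; have := @iter_tower_level n k 1; rewrite addn1 => /(_ kH). Qed.

(** The cutting number of the rank-one construction: of the [N n] copies of the [S]-tower,
    [m n * H n] are columns and the other [m n * C n] consist of spacers. *)
Definition columns n := m n * H n.

Definition column_bottom n i := i * L n + o n i.

(* Gap [i] precedes column [i]; gap [columns n] follows the last column. *)
Definition gap_start n i := if i is k.+1 then column_bottom n k + H n else 0.

Definition gap_length n i :=
  (if i < columns n then column_bottom n i else H n.+1) - gap_start n i.

Lemma column_bottom_lt n i : i < columns n -> column_bottom n i + H n < H n.+1.
Proof.
move=> iq; have := o_range n i; have LE : L n = H n + C n by [].
have -> : H n.+1 = columns n * L n by rewrite /columns mulnAC.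
have : i.+1 * L n <= columns n * L n by rewrite leq_mul2r iq orbT.
by rewrite /column_bottom mulSn; lia.
Qed.

Lemma gap_start_lt n i : i <= columns n ->
  gap_start n i < (if i < columns n then column_bottom n i else H n.+1).
Proof.
case: i => [|i] iq.
  case: ifP => [_|_]; last by rewrite stage_height_gt0.
  by rewrite /column_bottom addn_gt0 orbC; case/andP: (o_range n 0) => ->.
have h := column_bottom_lt iq; rewrite /gap_start; case: ifP => // _.
have := o_range n i; have := o_range n i.+1; have LE : L n = H n + C n by [].
by rewrite /column_bottom mulSn; lia.
Qed.

Lemma gap_length_gt0 n i : i <= columns n -> 0 < gap_length n i.
Proof. by move=> /gap_start_lt h; rewrite /gap_length subn_gt0. Qed.

Lemma spacersE n : spacers columns gap_length n + columns n * H n = H n.+1.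
Proof.
set h := H n.+1; rewrite /spacers big_ord_recr /= addnAC.
have sumE k : k <= columns n -> \sum_(i < k) gap_length n i + k * H n = gap_start n k.
  elim: k => [|k IH] kq; first by rewrite big_ord0.
  rewrite big_ord_recr /= mulSn.
  have := IH (ltnW kq); have := gap_start_lt (ltnW kq).
  by rewrite /gap_length kq; move: (\sum_(_ < _) _) => s; lia.
by rewrite sumE//; have := gap_start_lt (leqnn (columns n)); rewrite /gap_length ltnn -/h; lia.
Qed.

Lemma heightE n : height columns gap_length n = H n.
Proof. by elim: n => // n IH /=; rewrite IH addnC spacersE. Qed.

Lemma columns_gt1 n : 1 < columns n.
Proof. by rewrite /columns; have := m_gt1 n; have := stage_height_gt0 C m_gt0 n; nia. Qed.

Lemma tower_level_nonempty n k : k < H n -> tower_level n k !=set0.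
Proof.
rewrite -(radix_stage C m) => kn; have [pn pe] := crd_invP tauP kn.
exists (place n (crd_inv N tau n k) (digits_of N (fun=> 1))); split.
  (* The digit 1 is a copy at every rank, so the tail of ones is regular. *)
  move=> i ni; rewrite place_tail// digits_ofE// /column_digit modn_small ?stage_height_gt0//.
  by rewrite /stage_block; have := C_gt1 i; lia.
by rewrite pos_place.
Qed.

Lemma column_index_lt n d : d < N n -> good n d -> column_index C m n d < columns n.
Proof.
move=> dN /andP[v0 vH].
have um : d %/ L n < m n by rewrite ltn_divLR ?stage_block_gt0.
rewrite /column_index /columns; apply: (@leq_trans ((d %/ L n).+1 * H n)); last first.
  by rewrite leq_mul2r um orbT.
by rewrite mulSn; lia.
Qed.

Lemma column_index_ex n i : i < columns n ->
  exists d, [/\ d < N n, good n d & column_index C m n d = i].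
Proof.
move=> iq; have h := stage_height_gt0 C m_gt0 n; have LE : L n = H n + C n by [].
have lt := ltn_pmod i h; have c1 := C_gt1 n.
have vL : (i %% H n).+1 < L n by lia.
have um : i %/ H n < m n by rewrite ltn_divLR.
exists (i %/ H n * L n + (i %% H n).+1); split.
- apply: (@leq_trans ((i %/ H n).+1 * L n)); first by rewrite mulSn; lia.
  by rewrite leq_mul2r um orbT.
- by rewrite /column_digit modnMDl modn_small.
rewrite /column_index divnMDl ?stage_block_gt0// (divn_small vL) addn0.
by rewrite modnMDl (modn_small vL) /= -divn_eq.
Qed.

Lemma tower_level_split n : tower_level n 0 =
  \bigcup_(i in [set i | i < columns n]) tower_level n.+1 (column_bottom n i).
Proof.
apply/seteqP; split=> [x [xn x0]|x [i /= iq [xn xe]]].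
  have gx : good n (x n) by exact: xn.
  exists (column_index C m n (x n)) => /=; first exact: (column_index_lt (digit_lt N1 x n) gx).
  split; first exact: regularW xn.
  by rewrite (crd_pos_step N1 tauP gx) x0 addn0.
have [d [dN gd de]] := column_index_ex iq; have h0 := stage_height_gt0 C m_gt0 n.
have [pn pe] : crd_inv N tau n 0 < radix N n /\ tau n (crd_inv N tau n 0) = 0.
  by apply: (crd_invP tauP); rewrite radix_stage.
set p0 := crd_inv N tau n 0 in pn pe.
(* By injectivity of [tau], the position with digit [d] and old position [p0] is the only one at
   height [column_bottom n i]. *)
pose p := d * radix N n + p0.
have pd : p %/ radix N n = d by rewrite /p divnMDl ?radix_gt0// divn_small ?addn0.
have pm : p %% radix N n = p0 by rewrite /p modnMDl modn_small.
have pN : p < radix N n.+1.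
  rewrite radixS mulnC; apply: (@leq_trans (d.+1 * radix N n)); first by rewrite mulSn /p; lia.
  by rewrite leq_mul2r dN orbT.
have ep : pos x n.+1 = p.
  apply: (crd_inj tauP (pos_lt N1 x n.+1) pN).
  by rewrite xe (crd_step tauP pN) pd// pm pe addn0 /column_start de.
have xd : (x n : nat) = d by rewrite -(pos_div N1) ep pd.
split=> [j|]; last by rewrite -(pos_mod N1 x (leqnSn n)) ep pm.
by rewrite leq_eqVlt => /orP[/eqP <-|]; [rewrite xd|exact: xn].
Qed.

Hypothesis height_big : forall n, (2 ^ n.+1 * (C n.+1).+1) ^ 3 <= H n.+1.

(** There are [m n * H n * C n] spacers among [m n * L n * H n] levels, so the ratio is
    [C n / L n]. *)
Lemma spacers_summable : cvgn (series (fun n =>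
  (spacers columns gap_length n)%:R / (height columns gap_length n.+1)%:R : R)%R).
Proof.
apply: (@series_le_cvg _ _ (fun n => 2^-1 ^+ n)%R) => [n|n|n|].
- by rewrite divr_ge0.
- by rewrite exprn_ge0.
- rewrite heightE; have := spacersE n; have HE : H n.+1 = m n * L n * H n by [].
  have LE : L n = H n + C n by [].
  rewrite HE => e; have -> : spacers columns gap_length n = m n * H n * C n.
    by move: e; rewrite /columns LE; nia.
  apply: (le_trans _ (spacer_ratio m_gt0 height_big R n)).
  have m0 : ((m n)%:R != 0 :> R)%R by rewrite pnatr_eq0; have := m_gt0 n; lia.
  have h0 : ((H n)%:R != 0 :> R)%R by rewrite pnatr_eq0; have := stage_height_gt0 C m_gt0 n; lia.
  have l0 : ((L n)%:R != 0 :> R)%R by rewrite pnatr_eq0; have := stage_block_gt0 C m_gt0 n; lia.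
  rewrite !natrM le_eqVlt; apply/orP; left; apply/eqP; field.
  by rewrite m0 h0 l0.
have -> : (fun n => 2^-1 ^+ n)%R = geometric 1%R (2^-1 : R)%R.
  by apply/funext => n /=; rewrite mul1r.
by apply: is_cvg_geometric_series; rewrite ger0_norm ?invr_ge0// invf_lt1// ltr1n.
Qed.

(** The set [E] is the part of [A] in [G], the union of all the levels, which has full measure. It
    suffices to treat the sets prescribing one digit. *)
Lemma tower_level_generate (A : set (odometer_space N)) : measurable A ->
  exists2 E : set (odometer_space N),
    <<s [set J | exists n k, k < H n /\ J = tower_level n k] >> E &
    mu ((A `\` E) `|` (E `\` A)) = 0%E.
Proof.
set lv := [set J | _] => mA.
pose G := \bigcup_n (regular good n : set (odometer_space N)).
have mG : measurable G by apply: bigcupT_measurable => n; exact: measurable_regular.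
have lvLev n k : k < H n -> <<s lv >> (tower_level n k).
  by move=> kn; apply: sub_sigma_algebra; exists n, k.
have GE : G = \bigcup_n \bigcup_(k in [set k | k < H n]) tower_level n k.
  apply/seteqP; split=> [x [n _ xn]|x [n _ [k _ [xn _]]]]; last by exists n.
  exists n => //; exists (tau n (pos x n)) => //=.
  by rewrite -(radix_stage C m); exact: (crd_pos_lt N1 tauP).
have lvG : <<s lv >> G.
  rewrite GE; apply: (@bigcupT_measurable _ (g_sigma_algebraType lv)) => n.
  by apply: (@bigcup_measurable _ (g_sigma_algebraType lv)) => k; exact: lvLev.
exists (A `&` G).
  move: A mA; apply: smallest_sub; first split.
  - by rewrite /= set0I; apply: (@measurable0 _ (g_sigma_algebraType lv)).
  - move=> A /= AG; rewrite (_ : _ `&` G = G `\` (A `&` G)).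
      exact: (@measurableD _ (g_sigma_algebraType lv)).
    apply/seteqP; split=> x /=; first by move=> [[_ nA] Gx]; split=> // -[].
    by move=> [Gx nA]; split=> //; split=> // Ax; exact: nA.
  - move=> F /= FG; rewrite setI_bigcupl.
    exact: (@bigcupT_measurable _ (g_sigma_algebraType lv)).
  move=> _ [j [a ->]] /=.
  (* For [n > j] the height in tower [n] determines the position at rank [n], hence the digit of
     index [j]. *)
  rewrite (_ : _ `&` G = \bigcup_(n in [set n | j < n])
      \bigcup_(k in [set k | k < H n /\ crd_inv N tau n k %% radix N j.+1 %/ radix N j = a])
      tower_level n k).
    apply: (@bigcup_measurable _ (g_sigma_algebraType lv)) => n _.
    by apply: (@bigcup_measurable _ (g_sigma_algebraType lv)) => k [kn _]; exact: lvLev.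
  apply/seteqP; split=> [x [/= xa [n _ xn]]|x [n /= jn [k [/= kn ka] [xn xk]]]].
    pose l := maxn n j.+1; exists l => /=; first by rewrite leq_maxr.
    exists (tau l (pos x l)) => /=; last by split=> //; exact: regularW (leq_maxl _ _) xn.
    split; first by rewrite -(radix_stage C m); exact: (crd_pos_lt N1 tauP).
    rewrite (crd_invK tauP) ?pos_lt// (pos_mod N1) ?leq_maxr//.
    by rewrite pos_div// xa.
  split; last by exists n.
  apply/ord_inj; rewrite -ka -xk (crd_invK tauP) ?pos_lt// (pos_mod N1)//.
  by rewrite pos_div.
rewrite (_ : _ `|` _ = A `\` G).
  apply: measure_negligible; first exact: measurableD.
  apply: negligibleS (ae_regular m_gt0 C_gt1 height_big muN).
  by move=> x [_ nG] /= [n xn]; apply: nG; exists n.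
apply/seteqP; split=> x /=.
  by move=> [[Ax h]|[[Ax _] /(_ Ax)]//]; split=> // Gx; apply: h.
by move=> [Ax nG]; left; split=> // -[].
Qed.

Lemma tower_rank_one : rank_one T.
Proof.
exists columns, gap_length; split; [exact: columns_gt1|exact: spacers_summable|].
pose B n := tower_level n 0.
have TB n k : k < H n -> iter k T @` B n = tower_level n k.
  by move=> kn; rewrite /B iter_tower_level.
exists B, (fun n i => tower_level n.+1 (column_bottom n i)),
  (fun n i j => tower_level n.+1 (gap_start n i + j.-1)).
have sg n i j : i <= columns n -> j < gap_length n i -> gap_start n i + j < H n.+1.
  move=> iq; rewrite /gap_length; case: ifP => [iq'|_]; last by lia.
  by have := column_bottom_lt iq'; lia.
have bt n i : i < columns n -> gap_start n i + (gap_length n i).-1 = (column_bottom n i).-1.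
  by move=> iq; have := gap_start_lt (ltnW iq); rewrite /gap_length iq; lia.
have b0 n i : i < columns n -> 0 < column_bottom n i.
  by move=> iq; have := gap_start_lt (ltnW iq); rewrite iq; lia.
split.
- by move=> n; exact: measurable_tower_level.
- by move=> n i _; exact: measurable_tower_level.
- by move=> n i j _ _; exact: measurable_tower_level.
- move=> n i j /=; rewrite heightE => ik jk; rewrite !TB// => -[x [[_ <-] [_ <-]]] //.
- move=> n; split.
  + by rewrite /cover -tower_level_split.
  + move=> i j /= iq jq [x [[_ ei] [_ ej]]].
    have := o_range n i; have := o_range n j; have := stage_block_gt0 C m_gt0 n.
    have LE : L n = H n + C n by [].
    move: ej; rewrite ei => /(congr1 (divn^~ (L n))); rewrite /column_bottom => e l0 hj hi.
    by move: e; rewrite !divnMDl// !divn_small ?addn0//; lia.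
  + by move=> i iq; apply: tower_level_nonempty; have := column_bottom_lt iq; lia.
- move=> n i iq _; rewrite heightE iter_tower_level ?column_bottom_lt//=.
  by rewrite addn0.
(* All gaps are nonempty, so the cases of the structure without spacers do not occur. *)
- by move=> n i iq s0; have := gap_length_gt0 (ltnW iq); rewrite s0.
- move=> n i j iq /andP[j0 js]; rewrite image_tower_level.
    by congr (tower_level _ _); lia.
  by have := sg n i j iq js; lia.
- move=> n i iq s0; rewrite bt//; rewrite image_tower_level prednK ?b0//.
  by have := column_bottom_lt iq; lia.
- by [].
- by move=> n s0; have := gap_length_gt0 (leq0n (columns n)); rewrite s0.
move=> A mA; have [E EL E0] := tower_level_generate mA; exists E => //.
rewrite (_ : [set J | _] = [set J | exists n k, k < H n /\ J = tower_level n k])//.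
apply/seteqP; split=> J /= [n [k [kn ->]]]; exists n, k;
  move: kn; rewrite heightE => kn; split=> //.
  exact: TB.
by rewrite TB.
Qed.

End stage.

(** * The eigenfunction *)

Local Open Scope ring_scope.

Section near_integer.
Variable R : realType.

Definition near_part (r : R) : R := r - (Num.floor (r + 2^-1))%:~R.

Lemma near_part_half r : `|near_part r| <= 2^-1.
Proof.
by have := floor_itv (r + 2^-1); rewrite /near_part intrD ler_norml; lra.
Qed.

(** An integer other than the one subtracted in [near_part] is at distance at least 1 from it, hence
    at least 1/2 from [r]. *)
Lemma near_part_le r (k : int) : `|near_part r| <= `|r - k%:~R|.
Proof.
have h := near_part_half r; rewrite /near_part in h *; move: (Num.floor _) h => z h.
have [->//|zk] := eqVneq z k.
have : (1 : R) <= `|z%:~R - k%:~R|.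
  by rewrite -intrB -intr_norm -[1](mulr1z 1) ler_int; lia.
have : `|z%:~R - k%:~R| <= `|r - k%:~R| + `|r - z%:~R|.
  rewrite (_ : z%:~R - k%:~R = (r - k%:~R) - (r - z%:~R)); last lra.
  exact: ler_normB.
lra.
Qed.

Lemma cosDint (x : R) (k : int) : cos (x + 2 * pi * k%:~R) = cos x.
Proof.
have cosn (y : R) n : cos (y + 2 * pi * n%:R) = cos y.
  rewrite -(periodicn (@cosD2pi R) n y); congr (cos (_ + _)).
  by rewrite -[_ *+ 2 *+ n]mulr_natr -[pi *+ 2]mulr_natr [2 * pi]mulrC.
case: k => n; first exact: cosn.
by rewrite NegzE -(cosn (_ + _) n.+1) rmorphN /= mulrN subrK.
Qed.

Lemma sinDint (x : R) (k : int) : sin (x + 2 * pi * k%:~R) = sin x.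
Proof.
have sinn (y : R) n : sin (y + 2 * pi * n%:R) = sin y.
  rewrite -(periodicn (@sinD2pi R) n y); congr (sin (_ + _)).
  by rewrite -[_ *+ 2 *+ n]mulr_natr -[pi *+ 2]mulr_natr [2 * pi]mulrC.
case: k => n; first exact: sinn.
by rewrite NegzE -(sinn (_ + _) n.+1) rmorphN /= mulrN subrK.
Qed.

Lemma expiD (x y : R) : expi (x + y) = expi x * expi y.
Proof.
rewrite /expi cosD sinD; apply/eqP; rewrite eq_complex /=.
by apply/andP; split; apply/eqP; ring.
Qed.

Lemma expiDint (x : R) (k : int) : expi (x + 2 * pi * k%:~R) = expi x.
Proof. by rewrite /expi cosDint sinDint. Qed.

End near_integer.

Section stage.
Variables (C m : nat -> nat) (o : nat -> nat -> nat).
Hypothesis m_gt1 : forall n, (1 < m n)%N.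
Hypothesis C_gt1 : forall n, (1 < C n)%N.
Hypothesis o_range : forall n j, (0 < o n j < C n)%N.

Local Notation H := (stage_height C m).
Local Notation L := (stage_block C m).
Local Notation N := (stage_radix C m).
Local Notation good := (column_digit C m).
Local Notation tau := (tower_rank C m o).

Hypothesis height_big : forall n, ((2 ^ n.+1 * (C n.+1).+1) ^ 3 <= H n.+1)%N.

Let m_gt0 n : (0 < m n)%N. Proof. exact: ltnW. Qed.
Let N1 : forall n, (1 < N n)%N. Proof. exact: stage_radix_gt1. Qed.
Let tauP := tower_rank_coordinate m_gt0 C_gt1 o_range.

Context (R : realType) (mu : probability (odometer_space N) R) (theta : R).
Hypothesis muN : is_uniform_product mu.
Hypothesis o_phase : forall n j, exists k : int,
  `|theta * (j * L n + o n j)%:R - k%:~R| < 2^-1 ^+ n.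

Local Notation T := (tower_iso m_gt1 C_gt1 o_range muN).

Implicit Types x y : digits N.

Definition tpos x n : R := (tau n (pos x n))%:R.

(** Dropping the nearest integer at each rank keeps the sums equal to [theta] times the height
    modulo 1, while making them converge as real numbers. *)
Definition phase_step x n : R := near_part (theta * (tpos x n.+1 - tpos x n)).

Definition partial_phase x n : R := series (phase_step x) n.

Lemma partial_phaseS x n : partial_phase x n.+1 = partial_phase x n + phase_step x n.
Proof. by rewrite /partial_phase /series /= big_nat_recr. Qed.

Lemma partial_phase_int x n : exists k : int, partial_phase x n = theta * tpos x n - k%:~R.
Proof.
elim: n => [|n [k IH]].
  by exists 0; rewrite /partial_phase /series /= big_geq// /tpos /= mulr0 subr0.
exists (k + Num.floor (theta * (tpos x n.+1 - tpos x n) + 2^-1)).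
rewrite partial_phaseS IH.
by rewrite {1}/phase_step /near_part intrD; lra.
Qed.

Lemma tpos_regular n x : regular good n x -> forall k, (n <= k)%N ->
  tpos x k.+1 - tpos x k = (column_start C m o k (x k))%:R.
Proof.
move=> xn k nk; rewrite /tpos (crd_pos_step N1 tauP); last exact: xn.
by rewrite natrD addrK.
Qed.

(** From rank [n] on the increment is the bottom of a column, where [o_phase] applies. Earlier steps
    are at most 1/2, and the factor [2 ^+ n] absorbs them. *)
Lemma phase_step_le n x : regular good n x ->
  forall k, `|phase_step x k| <= 2 ^+ n * 2^-1 ^+ k.
Proof.
move=> xn k; have [nk|kn] := leqP n k.
  have [z hz] := o_phase k (column_index C m k (x k)).
  apply: (@le_trans _ _ (2^-1 ^+ k)).
    apply: le_trans (ltW hz); rewrite /phase_step (tpos_regular xn nk).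
    exact: near_part_le.
  by rewrite ler_peMl ?exprn_ge0// exprn_ege1// ler1n.
apply: le_trans (near_part_half _) _.
rewrite -(subnKC (ltnW kn)) exprD mulrAC -exprMn mulfV ?pnatr_eq0// expr1n mul1r.
by apply: (@le_trans _ _ 1); rewrite ?invf_le1 ?ler1n// exprn_ege1// ler1n.
Qed.

Lemma cvg_partial_phase n x : regular good n x -> cvgn (partial_phase x).
Proof.
move=> xn; apply: normed_cvg.
apply: (@series_le_cvg _ _ (fun k => 2 ^+ n * 2^-1 ^+ k)) => [k|k|k|].
- exact: normr_ge0.
- by rewrite mulr_ge0// exprn_ge0.
- exact: phase_step_le.
rewrite (_ : (fun k => _) = geometric (2 ^+ n) (2^-1 : R))//.
by apply: is_cvg_geometric_series; rewrite ger0_norm ?invr_ge0// invf_lt1// ltr1n.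
Qed.

(** At rank [n.+1] the map [T] adds 1 to the height, hence [theta] modulo 1 to the phase; all later
    steps agree because the tails do. *)
Lemma partial_phase_tower n x : regular good n x -> exists k : int,
  limn (partial_phase (T x)) = limn (partial_phase x) + theta + k%:~R.
Proof.
move=> xn; have xm := movable_ex N1 tauP xn; have [t e] := tower_up m_gt1 C_gt1 o_range muN xm.
set y := T x in t e *.
have xr := xm.1; have yr := regular_tail t xr.
have [k1 e1] := partial_phase_int x n.+1; have [k2 e2] := partial_phase_int y n.+1.
exists (k1 - k2).
pose c := theta + (k1 - k2)%:~R.
have cE : c = partial_phase y n.+1 - partial_phase x n.+1.
  rewrite e1 e2 /tpos; have -> : tau n.+1 (pos y n.+1) = (tau n.+1 (pos x n.+1)).+1 by exact: e.
  by rewrite -natr1 /c intrB; lra.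
have diff l : (n.+1 <= l)%N -> partial_phase y l = partial_phase x l + c.
  move=> /subnKC <-; elim: (l - n.+1)%N => [|i IH]; first by rewrite addn0 cE; lra.
  rewrite addnS (partial_phaseS y (n.+1 + i)) (partial_phaseS x (n.+1 + i)) IH.
  have -> : phase_step y (n.+1 + i) = phase_step x (n.+1 + i).
    by rewrite /phase_step !(tpos_regular xr, tpos_regular yr) ?leq_addr// t ?leq_addr.
  lra.
rewrite -addrA -/c; apply: cvg_lim => //.
apply: (@cvg_trans _ ((partial_phase x l + c) @[l --> \oo])).
  apply: near_eq_cvg; near=> l; rewrite diff//; near: l; exact: nbhs_infty_ge.
apply: cvgD; [exact: cvg_partial_phase xn|exact: cvg_cst].
Unshelve. all: by end_near. Qed.

Let G : set (odometer_space N) := \bigcup_n regular good n.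

Let mG : measurable G.
Proof. by apply: bigcupT_measurable => n; exact: measurable_regular. Qed.

Definition phase x : R := if `[< G x >] then limn (partial_phase x) else 0.

Lemma measurable_phase : measurable_fun setT (phase : odometer_space N -> R).
Proof.
apply: (@measurable_fun_cvg _ (odometer_space N) R setT
   (* The indicator makes the sequence converge at every point, including those outside [G]. *)
   (fun n x => \1_G x * partial_phase x n)) => [n|x _].
  apply: measurable_funM; first exact: measurable_indic.
  apply: measurable_sum => k _ B mB; rewrite setTI.
  pose g p := near_part (theta * ((tau k.+1 p)%:R - (tau k (p %% radix N k)%N)%:R)).
  have gE x : phase_step x k = g (pos x k.+1) by rewrite /phase_step /tpos /g pos_mod.
  rewrite (_ : _ @^-1` B = [set x : digits N | [set p | B (g p)] (pos x k.+1)]).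
    exact: measurable_pos.
  by apply/seteqP; split=> x; rewrite /preimage /mkset gE.
rewrite /phase indicE; case: asboolP => Gx.
  rewrite mem_set// (_ : (fun n => _) = partial_phase x); last first.
    by apply/funext => n; rewrite mul1r.
  by have [n _ xn] := Gx; exact: cvg_partial_phase xn.
rewrite memNset// (_ : (fun n => _) = fun=> 0); first exact: cvg_cst.
by apply/funext => n; rewrite mul0r.
Qed.

Definition eigenfunction x : R[i] :=
  ((\1_G x * cos (2 * pi * phase x)) +i* (\1_G x * sin (2 * pi * phase x)))%C.

Lemma tower_eigenvalue : is_eigenvalue T (expi (2 * pi * theta)).
Proof.
exists eigenfunction.
have mphase : measurable_fun setT (fun x : odometer_space N => 2 * pi * phase x).
  by apply: measurable_funM => //; exact: measurable_phase.
split.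
- split; apply: measurable_funM; try exact: measurable_indic.
    apply: (measurableT_comp (continuous_measurable_fun (@continuous_cos R)) mphase).
  apply: (measurableT_comp (continuous_measurable_fun (@continuous_sin R)) mphase).
- rewrite (eq_integral (fun x : odometer_space N => (\1_G x)%:E)) => [|x _].
    rewrite integral_indic// setIT; apply: le_lt_trans (probability_le1 mu mG) _.
    exact: ltry.
  congr _%:E; rewrite /= !exprMn -mulrDr cos2Dsin2 mulr1 indicE.
  by case: (x \in G); rewrite ?expr1n ?expr0n.
- move=> f0; have aeG := ae_regular m_gt0 C_gt1 height_big muN.
  have : mu setT = 0%E.
    apply: measure_negligible => //; apply: negligibleS (filterI f0 aeG).
    move=> x _ [] /= f0x [n xn]; have Gx : G x by exists n.
    move/eqP: f0x; rewrite eq_complex /= indicE mem_set// !mul1r => /andP[/eqP c0 /eqP s0].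
    have := cos2Dsin2 (2 * pi * phase x); rewrite c0 s0 expr0n addr0 => /eqP.
    by rewrite eq_sym oner_eq0.
  by rewrite (uniform_setT N1 muN) => /eqP; rewrite onee_eq0.
apply: negligibleS (ae_regular m_gt0 C_gt1 height_big muN) => x; apply: contra_not => -[n xn].
have Gx : G x by exists n.
have [t _] := tower_up m_gt1 C_gt1 o_range muN (movable_ex N1 tauP xn).
have GTx : G (T x).
  by exists n.+1 => //; exact: regular_tail t (regularW (leqnSn n) xn).
have fE y : G y -> eigenfunction y = expi (2 * pi * limn (partial_phase y)).
  by move=> Gy; rewrite /eigenfunction /phase asboolT// indicE mem_set// !mul1r.
change (eigenfunction (T x) = expi (2 * pi * theta) * eigenfunction x).
rewrite !fE//; have [k ->] := partial_phase_tower xn.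
by rewrite !(mulrDr (2 * pi)) expiDint expiD mulrC.
Qed.

End stage.

(** * The theorem *)

Local Open Scope ring_scope.

Section isomorphism.
Context (R : realType) d1 (X : measurableType d1) (mu : probability X R)
  d2 (Y : measurableType d2) (nu : probability Y R) (Psi : mp_iso mu nu).

Lemma ae_mp_inv (P : X -> Prop) :
  {ae mu, forall x, P x} -> {ae nu, forall y, P (mp_inv Psi y)}.
Proof.
move=> [A [mA A0 PA]].
have mB : measurable (mp_inv Psi @^-1` A).
  exact: measurable_preimageT (measurable_mp_inv Psi) mA.
exists (mp_inv Psi @^-1` A); split=> //.
  rewrite -(mp_pushforward Psi mB) /pushforward -[RHS]A0; congr (mu _).
  by apply/seteqP; split=> x /=; rewrite mp_funK.
by move=> y nP; apply: PA.
Qed.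

Lemma ge0_integral_mp_inv (f : X -> \bar R) :
  measurable_fun setT f -> (forall x, (0 <= f x)%E) ->
  (\int[nu]_y f (mp_inv Psi y) = \int[mu]_x f x)%E.
Proof.
move=> mf f0.
pose m := measure_function_pushforward__canonical__measure_function_Measure mu
  (measurable_mp_fun Psi).
rewrite (eq_measure_integral m) => [|A mA _]; last exact: (esym (mp_pushforward Psi mA)).
rewrite ge0_integral_pushforward//=.
- by apply: eq_integral => x _; rewrite /= mp_funK.
- exact: measurable_mp_fun.
- exact: measurableT_comp mf (measurable_mp_inv Psi).
Qed.

Variables (S : automorphism mu) (S' : automorphism nu).
Hypothesis conj : forall x, Psi (S x) = S' (Psi x).

Lemma iterz_conj k x : Psi (iterz S k x) = iterz S' k (Psi x).
Proof.
case: k => n; rewrite /iterz.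
  by elim: n => //= n IH; rewrite conj IH.
elim: n.+1 => //= k IH; rewrite -IH; apply: (can_inj (mp_funK S')).
by rewrite mp_invK -conj mp_invK.
Qed.

End isomorphism.

(** A prime [p] divides [q n] as soon as [n >= p], so the ranks from [p] to [p + M - 1] already
    supply multiplicity [M]. *)
Lemma universal_of_factorial (q : nat -> nat) :
  (forall n, 1 < q n)%N -> (forall n, n.+1`! %| q n)%N -> universal_seq q.
Proof.
move=> q_gt1 qf; split=> // p pp M; exists (p + M)%N.
rewrite -(big_mkord xpredT (fun n => logn p (q n))) (@big_cat_nat _ _ _ p)//= ?leq_addr//.
apply: leq_trans (leq_addl _ _).
apply: (@leq_trans (\sum_(p <= n < p + M) 1)%N).
  by rewrite sum_nat_const_nat addKn muln1.
rewrite !big_seq; apply: leq_sum => n; rewrite mem_index_iota => /andP[pn _].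
rewrite logn_gt0 mem_primes pp (ltnW (q_gt1 n)) /=.
by apply: dvdn_trans (qf n); apply: dvdn_fact; rewrite prime_gt0// leqW.
Qed.

(** With [eps = 1] the bound holds past some [M]; the sum of the values of [phi] at the naturals up
    to [M] takes care of the others. *)
Lemma third_power_bound (R : realType) (phi : R -> R) :
  (forall t : R, 0 <= t -> 0 <= phi t) ->
  (forall eps : R, 0 < eps -> \forall t \near +oo, `|phi t| <= eps * `|t `^ (3^-1)|) ->
  exists2 D : R, 0 <= D & forall k : nat, phi k%:R <= weight D k.
Proof.
move=> phi0 /(_ 1 ltr01)[M [_ PM]].
exists (1 + \sum_(j < (Num.truncn M).+1) phi j%:R).
  by rewrite addr_ge0// sumr_ge0// => j _; exact: phi0.
move=> k; set s := \sum_(j < _) _.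
have s0 : 0 <= s by rewrite sumr_ge0// => j _; exact: phi0.
have w0 : 0 <= k%:R `^ 3^-1 :> R by exact: powR_ge0.
have [kM|Mk] := ltnP k (Num.truncn M).+1.
  apply: (@le_trans _ _ s); last by rewrite /weight; nra.
  by rewrite /s (bigD1 (Ordinal kM))//= lerDl sumr_ge0// => j _; exact: phi0.
have /PM : M < k%:R.
  by apply: lt_le_trans (real_truncnS_gt (num_real M)) _; rewrite ler_nat.
rewrite mul1r ger0_norm ?phi0// ger0_norm// => h.
by apply: le_trans h _; rewrite /weight; nra.
Qed.

Theorem theorem5 (R : realType) (phi : R -> R) (theta : R)
  (phi_ge0 : forall t : R, 0 <= t -> 0 <= phi t)
  (phi_o : forall eps : R, 0 < eps ->
    \forall t \near +oo, `|phi t| <= eps * `|t `^ (3^-1)|)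
  (theta_irr : irrational theta) :
  exists (d : measure_display) (X : measurableType d) (mu : probability X R)
         (T : automorphism mu),
    [/\ standard_borel R X,
        atomless mu,
        rank_one T,
        is_eigenvalue T (expi (2 * pi * theta)) &
        forall q : nat -> nat, universal_seq q ->
          exists (nu : probability (odometer_space q) R) (S : automorphism nu),
            is_odometer S /\ integrably_orbit_equivalent phi T S].
Proof.
have [D D0 phiD] := third_power_bound phi_ge0 phi_o.
have p2 n : 0 < 2^-1 ^+ n :> R by rewrite exprn_gt0.
have [C CP] := boolp.choice (fun n => return_times theta_irr (p2 n)).
have C_gt1 n : (1 < C n)%N by case: (CP n).
(* The factorial makes the odometer universal; the cube, which involves [C] at the next rank, gives
   [height_big]. *)
pose m n := (n.+1`! * (2 ^ n.+1 * (C n.+1).+1) ^ 3)%N.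
have cube n : (1 < (2 ^ n.+1 * (C n.+1).+1) ^ 3)%N.
  apply: leq_trans (leq_expn3 _); rewrite -[1%N]muln1.
  apply: (@leq_trans (2 * 1)%N) => //; apply: leq_mul => //.
  by rewrite -{1}(expn1 2) leq_exp2l.
have m_gt1 n : (1 < m n)%N by apply: leq_trans (cube n) _; rewrite leq_pmull// fact_gt0.
have m_gt0 n : (0 < m n)%N by exact: ltnW.
(* The block starts at height [j * L n]; the return time from the phase [theta * (j * L n)] is the
   offset of its column. *)
have ex_o n j : exists c, (0 < c < C n)%N /\
    exists k : int, `|theta * (j * stage_block C m n + c)%:R - k%:~R| < 2^-1 ^+ n.
  have [_ /(_ (theta * (j * stage_block C m n)%:R))[c [k [cC h]]]] := CP n.
  by exists c; split=> //; exists k; rewrite natrD mulrDr [theta * c%:R]mulrC.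
have [off offP] := boolp.choice (fun nj : nat * nat => ex_o nj.1 nj.2).
have o_range n j : (0 < off (n, j) < C n)%N by have [] := offP (n, j).
have o_phase n j : exists k : int,
    `|theta * (j * stage_block C m n + off (n, j))%:R - k%:~R| < 2^-1 ^+ n.
  by have [] := offP (n, j).
have height_big n : ((2 ^ n.+1 * (C n.+1).+1) ^ 3 <= stage_height C m n.+1)%N.
  rewrite stage_heightS /stage_radix /m mulnAC -mulnA; apply: (leq_trans _ (leq_pmulr _ _)).
    by rewrite leq_pmull// fact_gt0.
  by rewrite muln_gt0 stage_block_gt0// stage_height_gt0.
have N_univ : universal_seq (stage_radix C m).
  apply: universal_of_factorial => n; first exact: stage_radix_gt1.
  by rewrite /stage_radix /m -mulnA dvdn_mulr.
have N1 := stage_radix_gt1 m_gt0 C_gt1.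
have [mu muN] := exists_uniform N1 R.
pose ofun n j := off (n, j).
pose T := tower_iso m_gt1 C_gt1 (o_range : forall n j, (0 < ofun n j < C n)%N) muN.
exists _, (odometer_space (stage_radix C m)), mu, T; split.
- exact: standard_borel_odometer.
- exact: atomless_odometer.
- exact: tower_rank_one.
- exact: tower_eigenvalue.
move=> q q_univ; have q_gt1 : forall n, (1 < q n)%N by case: q_univ.
have [nu nuq] := exists_uniform q_gt1 R.
exists nu, (odometer_iso q_gt1 nuq); split; first exact: odometer_isoP.
have aeR := ae_regular m_gt0 C_gt1 height_big muN.
have tauP := tower_rank_coordinate m_gt0 C_gt1 (o_range : forall n j, (0 < ofun n j < C n)%N).
have posP := pos_coordinate m_gt0 C_gt1.
(* [T] and the odometer of base [stage_radix C m] share their space and almost all orbits, so the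
   orbit equivalence with the odometer of base [q] is just the conjugacy between the two
   odometers. *)
pose Psi := rebase_iso N_univ q_univ muN nuq.
have conj x : Psi (odometer_iso N1 muN x) = odometer_iso q_gt1 nuq (Psi x).
  exact: rebase_odometer.
have conjz k x : iterz (odometer_iso N1 muN) k x =
    mp_inv Psi (iterz (odometer_iso q_gt1 nuq) k (Psi x)).
  by rewrite -(iterz_conj conj) mp_funK.
have pos_block n p : (p < radix (stage_radix C m) n.+1)%N ->
  (p %/ (stage_block C m n * stage_height C m n) =
   p %/ (stage_block C m n * stage_height C m n))%N by [].
have tau_block n p : (p < radix (stage_radix C m) n.+1)%N ->
  (tower_rank C m ofun n.+1 p %/ (stage_block C m n * stage_height C m n) =
   p %/ (stage_block C m n * stage_height C m n))%N.
  by rewrite radix_stage; exact: tower_rank_div.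
split.
- apply: negligibleS aeR => x; apply: contra_not => -[n xn] k k0.
  exact: tower_iter_neq xn k0.
- by apply: aeW => x k k0; exact: (iter_odometer_neq q_gt1).
exists Psi; split.
  apply: negligibleS aeR => x; apply: contra_not => -[n xn].
  rewrite /= (tower_orbit m_gt1 C_gt1 _ muN xn) /orbit.
  apply/seteqP; split=> [_ [k _ <-]|_ [_ [k _ <-] <-]].
    by exists (iterz (odometer_iso q_gt1 nuq) k (Psi x)); [exists k|exact: (esym (conjz k x))].
  by exists k => //; exact: (conjz k x).
exists (cocycle (column_digit C m) (tower_rank C m ofun) (fun=> id)),
  (cocycle (column_digit C m) (fun=> id) (tower_rank C m ofun) \o mp_inv Psi); split.
- split=> k; first exact: (measurable_cocycle N1 tauP posP).
  exact: (measurable_preimageT (measurable_mp_inv Psi) (measurable_cocycle N1 posP tauP k)).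
- apply: aeW => x; apply: etrans (conjz _ x); exact: tower_iter_int.
- apply: negligibleS (ae_mp_inv Psi aeR) => y; apply: contra_not => -[n xn].
  have := odometer_iter_int m_gt1 C_gt1 (o_range : forall n j, (0 < ofun n j < C n)%N) muN xn.
  by move=> /(congr1 Psi); rewrite conj mp_invK.
- exact: (cocycle_integral m_gt0 C_gt1 height_big muN tauP posP tau_block pos_block
    phi_ge0 phiD D0).
rewrite (ge0_integral_mp_inv Psi (f := fun x =>
  (phi (absz (cocycle (column_digit C m) (fun=> id) (tower_rank C m ofun) x))%:R)%:E)).
- exact: (cocycle_integral m_gt0 C_gt1 height_big muN posP tauP pos_block tau_block
    phi_ge0 phiD D0).
- exact: (measurable_fun_discrete (fun k => (phi (absz k)%:R)%:E)
    (measurable_cocycle N1 posP tauP)).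
- by move=> x; rewrite lee_fin phi_ge0.
Qed.
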